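(* Let $(M,\tau)$ be a tracial $W^*$-probability space and $B\subset M$ a unital $*$-subalgebra. Let $X_1,\dots,X_n\in M$ be selfadjoint and let $J_1,\dots,J_n\in L^2(X_1,\dots,X_n,B)$. Let $D\subset B$ be a unital $*$-subalgebra with conditional expectation $E:M\to D$ such that $\tau\circ E=\tau$. Then the defining equations for $J_1,\dots,J_n$ to be the conjugate variables $J_i=J_i(X_1,\dots,X_n:B)$ of $X_1,\dots,X_n$ with respect to $B$, namely $$\tau(J_ib_1X_{i_1}b_2\cdots b_mX_{i_m}b_{m+1})=\sum_{r=1}^m\delta_{i i_r}\,\tau(b_1X_{i_1}b_2\cdots X_{i_{r-1}}b_r)\,\tau(b_{r+1}X_{i_{r+1}}\cdots b_mX_{i_m}b_{m+1})$$ for all $m\ge0$, all $b_1,\dots,b_{m+1}\in B$, all $1\le i,i_1,\dots,i_m\le n$ (for $m=0$: $\tau(J_ib)=0$ for all $b\in B$), are equivalent to the following system of equations in terms of $D$-valued cumulants: $$\kappa^D(J_i)=0,\qquad \kappa^D(J_i,da)=\delta_{a,X_i}\,\tau(d),\qquad \kappa^D(J_i,d_1a_1,\dots,d_ma_m)=0$$ for all $m\ge2$, all $i=1,\dots,n$, all $d,d_1,\dots,d_m\in D$ and all $a,a_1,\dots,a_m\in\{X_1,\dots,X_n\}\cup B$.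
   Context: A tracial $W^*$-probability space $(M,\tau)$ is a von Neumann algebra $M$ with a faithful normal trace (tracial state) $\tau$. $L^2(S_1,\dots,S_p)$ is the closure, in $\|a\|_{L^2}^2=\tau(aa^* )$, of the von Neumann algebra generated by the $S_i$. A conditional expectation $E:M\to D$ is a unital $D$-bimodule linear map; being $\tau$-preserving, it extends to $L^2(M,\tau)$. $D$-valued cumulants: $\kappa^D$ is the family of $\mathbb C$-multilinear, $D$-balanced maps ($\kappa^D(dm_1,\dots)=d\kappa^D(m_1,\dots)$, $\kappa^D(\dots,m_nd)=\kappa^D(\dots,m_n)d$, $\kappa^D(\dots,m_jd,m_{j+1},\dots)=\kappa^D(\dots,m_j,dm_{j+1},\dots)$) determined recursively by $E(m_1\cdots m_n)=\sum_{\pi\in NC(n)}\kappa^D_\pi(m_1,\dots,m_n)$, where $NC(n)$ denotes non-crossing partitions of $\{1,\dots,n\}$, $\kappa^D_{1_n}=\kappa^D$ for the one-block partition, and, if $\{p+1,\dots,p+q\}$ is an interval block of $\pi$ (not the only block) and $\pi'$ is $\pi$ with this block removed, $\kappa^D_\pi(m_1,\dots,m_n)=\kappa^D_{\pi'}(m_1,\dots,m_p\kappa^D(m_{p+1},\dots,m_{p+q}),m_{p+q+1},\dots,m_n)$ (for $p=0$ the value multiplies $m_{q+1}$ from the left). The same formulas define $\kappa^D(\xi,m_2,\dots,m_n)$ for a first argument $\xi\in L^2(M,\tau)$, using the extension of $E$. In $\delta_{a,X_i}$, with $a\in\{X_1,\dots,X_n\}\cup B$, the $X_j$ are treated as distinct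 symbols, not elements of $B$: it is $1$ if $a$ is the variable $X_i$ and $0$ if $a$ is $X_j$ with $j\ne i$ or $a\in B$. *)

(* Defs.v *)
From HB Require Import structures.
From mathcomp Require Import all_boot all_order all_algebra.
From mathcomp Require Import complex.
From mathcomp Require Import boolp classical_sets topology normedtype reals.
Set Implicit Arguments.
Unset Strict Implicit.
Unset Printing Implicit Defensive.
Import Order.TTheory GRing.Theory Num.Theory.
Import numFieldNormedType.Exports.
Local Open Scope classical_set_scope.
Local Open Scope complex_scope.
Local Open Scope ring_scope.

(* Inner products are linear in the first variable.  A Hilbert space is a
   complete normed R[i]-module whose norm comes from an inner product. *)
Definition hilbert (R : realType) (H : normedModType R[i])
    (dot : {dot H for Num.conj}) : Prop :=
  forall u : H, `|u| ^+ 2 = dot u u.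

Section VonNeumannAlgebra.
Variables (R : realType) (H : normedModType R[i]).
Variable dot : {dot H for Num.conj}.

Definition bounded_operator (T : H -> H) : Prop := linear T /\ continuous T.

Definition adjoint_of (T S : H -> H) : Prop :=
  forall u v, dot (T u) v = dot u (S v).

Definition positive_operator (T : H -> H) : Prop := forall u, 0 <= dot (T u) u.

Definition commutant (A : set (H -> H)) : set (H -> H) :=
  [set T | bounded_operator T /\ forall S, A S -> T \o S = S \o T].

(* A selfadjoint set of bounded operators equal to its bicommutant. *)
Definition von_neumann_algebra (A : set (H -> H)) : Prop :=
  [/\ A `<=` bounded_operator,
      forall T, A T -> exists2 S, A S & adjoint_of T S
    & commutant (commutant A) = A].

Variables (M : algType R[i]) (star : M -> M) (rep : M -> H -> H).

(* The algebra M with involution star is, through the faithful unital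
   *-representation rep, a von Neumann algebra of operators on H.  The axioms
   of an involution for star follow from the injectivity of rep. *)
Definition is_von_neumann : Prop :=
  [/\ injective rep,
      rep 1 = id /\ (forall a b, rep (a * b) = rep a \o rep b),
      forall (c : R[i]) a b u, rep (c *: a + b) u = c *: rep a u + rep b u,
      forall a, adjoint_of (rep a) (rep (star a))
    & von_neumann_algebra (range rep)].

Definition vN_le (a b : M) : Prop := positive_operator (rep (b - a)).

Definition vN_lub (F : set M) (a : M) : Prop :=
  (forall x, F x -> vN_le x a) /\
  (forall b, (forall x, F x -> vN_le x b) -> vN_le a b).

Definition vN_generated (S : set M) : set M :=
  smallest (fun N : set M => von_neumann_algebra (rep @` N)) S.

Variable tau : M -> R[i].

Definition normal_functional : Prop :=
  forall (F : set M) (a : M),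
    F !=set0 -> (forall x, F x -> vN_le 0 x) ->
    (forall x y, F x -> F y -> exists z, [/\ F z, vN_le x z & vN_le y z]) ->
    vN_lub F a ->
    forall c : R[i], (forall x, F x -> tau x <= c) -> tau a <= c.

Definition faithful_normal_tracial_state : Prop :=
  [/\ (forall (c : R[i]) a b, tau (c *: a + b) = c * tau a + tau b) /\
        tau 1 = 1,
      forall a, vN_le 0 a -> 0 <= tau a,
      forall a b, tau (a * b) = tau (b * a),
      forall a, tau (a * star a) = 0 -> a = 0
    & normal_functional].

End VonNeumannAlgebra.

Section Subalgebras.
Variables (R : realType) (M : algType R[i]) (star : M -> M).

Definition unital_star_subalgebra (A : set M) : Prop :=
  [/\ A 1,
      forall (c : R[i]) a b, A a -> A b -> A (c *: a + b),
      forall a b, A a -> A b -> A (a * b)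
    & forall a, A a -> A (star a)].

Definition conditional_expectation (D : set M) (E : M -> M) : Prop :=
  [/\ forall (c : R[i]) a b, E (c *: a + b) = c *: E a + E b,
      E 1 = 1,
      forall m, D (E m)
    & forall d m d', D d -> D d' -> E (d * m * d') = d * E m * d'].

End Subalgebras.

Section L2Space.
Variables (R : realType) (M : algType R[i]) (star : M -> M) (tau : M -> R[i]).
Variables (K : completeNormedModType R[i]) (dotK : {dot K for Num.conj}).
Variable iota : M -> K.

(* The Hilbert space K, with iota, is the completion of M for the norm
   `|a| ^+ 2 = tau (a * star a). *)
Definition is_L2 : Prop :=
  [/\ hilbert dotK,
      forall (c : R[i]) a b, iota (c *: a + b) = c *: iota a + iota b,
      forall a b, dotK (iota a) (iota b) = tau (a * star b)
    & closure (range iota) = setT].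

(* The extension by continuity to K of a map g defined on M. *)
Definition L2_ext (T : normedModType R[i]) (g : M -> T) (xi : K) : T :=
  xget 0 [set y | forall u : nat -> M,
    iota (u k) @[k --> \oo] --> xi -> g (u k) @[k --> \oo] --> y].

Definition L2_tau : K -> R[i] := L2_ext (tau : M -> R[i]^o).

Definition L2_mulr (xi : K) (a : M) : K := L2_ext (fun x => iota (x * a)) xi.

Definition L2_condexp (E : M -> M) : K -> K := L2_ext (iota \o E).

Variables (H : normedModType R[i]) (dotH : {dot H for Num.conj}).
Variable rep : M -> H -> H.

Definition L2_generated (S : set M) : set K :=
  closure (iota @` vN_generated dotH rep S).

End L2Space.

Section NonCrossing.
Local Open Scope nat_scope.
Variable n : nat.

Definition crossing (V W : {set 'I_n}) : bool :=
  [exists a in V, exists b in W, exists c in V, exists d in W,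
    [&& a < b, b < c & c < d]].

Definition noncrossing (p : {set {set 'I_n}}) : bool :=
  finset.partition p [set: 'I_n]%SET &&
  [forall V in p, forall W in p, (V != W) ==> ~~ crossing V W].

Definition one_block : {set {set 'I_n}} := [set [set: 'I_n]%SET]%SET.

Definition block_min (p : {set {set 'I_n}}) (i : 'I_n) : bool :=
  [forall j in finset.pblock p i, i <= j].

End NonCrossing.

(* kappa_p for arguments xi, s_1, ..., s_n labelled by 0, 1, ..., n.  The first
   argument lives in a right module L over the algebra A of the other ones (with
   L = A in the case of A-valued cumulants).  kA and kL are the cumulants
   attached to a single block, without and with the first argument.

   The blocks not containing 0 are removed by decreasing least element i.  For
   a noncrossing p, the block with least element i is then an interval of the
   labels that are left, and its left neighbour is i - 1, so its cumulant is
   multiplied on the right of the argument i - 1; as the D-valued cumulants are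
   D-balanced, any other order of removal of interval blocks gives the same
   value.  The entry 0 of the family of arguments starts at 1 and collects the
   factors to the right of xi. *)
Section PartitionedCumulant.
Variables (A : pzRingType) (L : Type) (act : L -> A -> L).
Variables (kA : seq A -> A) (kL : L -> seq A -> L).

Definition remove_block n (p : {set {set 'I_n.+1}}) (i : 'I_n.+1)
    (m : 'I_n.+1 -> A) : 'I_n.+1 -> A :=
  if (i != ord0) && block_min p i then
    let v := kA [seq m l | l <- enum (finset.pblock p i)] in
    fun j : 'I_n.+1 => if j.+1 == i :> nat then m j * v else m j
  else m.

Definition remove_blocks n (p : {set {set 'I_n.+1}}) (m : 'I_n.+1 -> A) :=
  foldr (remove_block p) m (enum 'I_n.+1).

Definition partition_cumulant (xi : L) (s : seq A)
    (p : {set {set 'I_(size s).+1}}) : L :=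
  let m := remove_blocks p (fun j => nth 1 (1 :: s) j) in
  kL (act xi (m ord0))
     [seq m l | l <- behead (enum (finset.pblock p ord0))].

End PartitionedCumulant.

(* The D-valued cumulants, obtained by solving the moment-cumulant formula for
   the term of the one-block partition.  The first argument of the Fixpoints
   only bounds the depth of the recursion. *)
Section Cumulants.
Variables (A : pzRingType) (E : A -> A).

Definition uncons_cumulant (k : A -> seq A -> A) (s : seq A) : A :=
  if s is m :: s' then k m s' else 0.

Fixpoint cumulant_rec (f : nat) (m : A) (s : seq A) : A :=
  if f is f'.+1 then
    E (m * \prod_(x <- s) x) -
    \sum_(p | noncrossing p && (p != one_block (size s).+1))
      partition_cumulant *%R (uncons_cumulant (cumulant_rec f'))
        (cumulant_rec f') m p
  else 0.

(* cumulant m1 [:: m2; ..; mn] is kappa^D(m1, ..., mn) *)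
Definition cumulant (m : A) (s : seq A) : A := cumulant_rec (size s).+1 m s.

Variables (L : zmodType) (act : L -> A -> L) (EL : L -> L).

Fixpoint module_cumulant_rec (f : nat) (xi : L) (s : seq A) : L :=
  if f is f'.+1 then
    EL (act xi (\prod_(x <- s) x)) -
    \sum_(p | noncrossing p && (p != one_block (size s).+1))
      partition_cumulant act (uncons_cumulant cumulant)
        (module_cumulant_rec f') xi p
  else 0.

Definition module_cumulant (xi : L) (s : seq A) : L :=
  module_cumulant_rec (size s).+1 xi s.

End Cumulants.

Section MomentCumulant.
Variables (A : pzRingType).

Lemma noncrossing_one_block n : noncrossing (one_block n.+1).
Proof.
apply/andP; split.
  apply/and3P; split.
  - by apply/eqP; rewrite finset.cover1.
  - by apply: finset.trivIset1.
  - by rewrite inE eq_sym; apply/set0Pn; exists ord0; rewrite inE.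
by apply/'forall_implyP => V /set1P -> ; apply/'forall_implyP => W /set1P ->;
  rewrite eqxx.
Qed.

Lemma pblock_one_block n (i : 'I_n) :
  finset.pblock (one_block n) i = [set: 'I_n]%SET.
Proof. by apply: finset.def_pblock; rewrite ?finset.trivIset1 ?inE. Qed.

Lemma eq_partition_cumulant (L : Type) (act : L -> A -> L) kA kA' kL kL'
    (xi : L) (s : seq A) (p : {set {set 'I_(size s).+1}}) :
  (forall t, (size t <= size s)%N -> kA t = kA' t) ->
  (forall eta t, (size t < size s)%N -> kL eta t = kL' eta t) ->
  finset.partition p [set: 'I_(size s).+1]%SET -> p != one_block (size s).+1 ->
  partition_cumulant act kA kL xi p = partition_cumulant act kA' kL' xi p.
Proof.
move=> eqA eqL pP pn1; rewrite /partition_cumulant.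
have -> : remove_blocks kA' p = remove_blocks kA p.
  apply/funext => m; rewrite /remove_blocks; elim: (enum _) => //= i r ->.
  rewrite /remove_block; case: ifP => // /andP[i0 imin].
  rewrite eqA // size_map -cardE -ltnS -[X in (_ < X)%N]card_ord.
  rewrite -cardsT; apply/proper_card; rewrite properT.
  apply/eqP => VT; move/forall_inP: imin => /(_ ord0).
  rewrite VT inE => /(_ isT); rewrite leqn0 => i0'.
  by move/negP: i0; apply; apply/eqP/val_inj/eqP.
apply: eqL; rewrite size_map size_behead -cardE.
have c0 : ord0 \in finset.cover p by rewrite (finset.cover_partition pP) inE.
have pos : (0 < #|finset.pblock p ord0|)%N.
  by apply/card_gt0P; exists ord0; rewrite finset.mem_pblock.
rewrite -ltnS prednK // -[X in (_ < X)%N]card_ord -cardsT.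
apply/proper_card; rewrite properT; apply: contra pn1 => /eqP VT.
have Tp : [set: 'I_(size s).+1]%SET \in p by rewrite -VT finset.pblock_mem.
apply/eqP/setP => V; rewrite inE; apply/idP/eqP => [Vp|->//].
have /finset.set0Pn[x xV] : V != finset.set0.
  by apply: contraTneq Vp => ->; case/and3P: pP.
have tI : finset.trivIset p by case/and3P: pP.
by rewrite -(finset.def_pblock tI Vp xV) (finset.def_pblock tI Tp) ?inE.
Qed.

Lemma partition_cumulant_one (L : Type) (act : L -> A -> L) kA kL
    (xi : L) (s : seq A) :
  partition_cumulant act kA kL xi (one_block (size s).+1) = kL (act xi 1) s.
Proof.
rewrite /partition_cumulant pblock_one_block.
have -> m : remove_blocks kA (one_block (size s).+1) m = m.
  rewrite /remove_blocks; elim: (enum _) => //= i r ->.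
  rewrite /remove_block; case: ifP => // /andP[i0 /forall_inP/(_ ord0)].
  rewrite pblock_one_block inE leqn0 => /(_ isT) i0'.
  by move/negP: i0; case; apply/eqP/val_inj/eqP.
congr kL; rewrite (_ : enum _ = enum 'I_(size s).+1); last first.
  by apply: eq_enum => x; rewrite !inE.
rewrite enum_ordSl /= -map_comp.
rewrite -[RHS](mkseq_nth 1) /mkseq -val_enum_ord -map_comp.
by apply: eq_map => x /=.
Qed.

Lemma cumulant_recE (E : A -> A) f m s : (size s < f)%N ->
  cumulant_rec E f m s = cumulant E m s.
Proof.
suff H g h : (size s < g)%N -> (size s < h)%N ->
    cumulant_rec E g m s = cumulant_rec E h m s.
  by move=> sf; apply: H.
elim: g h m s => [//|g IH] [//|h] m s sg sh /=; congr (_ - _).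
apply: eq_bigr => p /andP[/andP[pP _] pn1].
apply: eq_partition_cumulant => // [[|x t] //= ts|eta t ts]; apply: IH;
  by rewrite (leq_trans ts).
Qed.

Lemma moment_cumulant (E : A -> A) m s :
  E (m * \prod_(x <- s) x) =
  \sum_(p | noncrossing p)
    partition_cumulant *%R (uncons_cumulant (cumulant E)) (cumulant E) m
      (p : {set {set 'I_(size s).+1}}).
Proof.
rewrite (bigD1 (one_block _)) ?noncrossing_one_block //= partition_cumulant_one.
rewrite mulr1; apply/eqP; rewrite -subr_eq; apply/eqP.
rewrite [RHS]/cumulant /=; congr (_ - _).
apply: eq_bigr => p /andP[/andP[pP _] pn1].
by apply: eq_partition_cumulant => // [[|x t] //= ts|eta t ts];
  rewrite cumulant_recE.
Qed.

Lemma module_moment_cumulant (E : A -> A) (L : zmodType) (act : L -> A -> L)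
    (EL : L -> L) xi s : act xi 1 = xi ->
  EL (act xi (\prod_(x <- s) x)) =
  \sum_(p | noncrossing p)
    partition_cumulant act (uncons_cumulant (cumulant E))
      (module_cumulant E act EL) xi (p : {set {set 'I_(size s).+1}}).
Proof.
have recE f eta t : (size t < f)%N ->
    module_cumulant_rec E act EL f eta t = module_cumulant E act EL eta t.
  suff H g h : (size t < g)%N -> (size t < h)%N ->
      module_cumulant_rec E act EL g eta t =
      module_cumulant_rec E act EL h eta t.
    by move=> tf; apply: H.
  elim: g h eta t => [//|g IH] [//|h] eta t tg th /=; congr (_ - _).
  apply: eq_bigr => p /andP[/andP[pP _] pn1].
  apply: eq_partition_cumulant => // zeta u us; apply: IH;
    by rewrite (leq_trans us).
move=> xi1.
rewrite (bigD1 (one_block _)) ?noncrossing_one_block //= partition_cumulant_one.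
rewrite xi1; apply/eqP; rewrite -subr_eq; apply/eqP.
rewrite [RHS]/module_cumulant /=; congr (_ - _).
apply: eq_bigr => p /andP[/andP[pP _] pn1].
by apply: eq_partition_cumulant => // zeta u us; rewrite recE.
Qed.

End MomentCumulant.

(* kappa^D(xi, m2, ..., mn) for xi in L^2(M, tau) *)
Definition L2_cumulant (R : realType) (M : algType R[i])
    (K : completeNormedModType R[i]) (iota : M -> K) (E : M -> M) :
    K -> seq M -> K :=
  module_cumulant E (L2_mulr iota) (L2_condexp iota E).

Section Equations.
Variables (R : realType) (M : algType R[i]) (star : M -> M) (tau : M -> R[i]).
Variables (K : completeNormedModType R[i]) (iota : M -> K).
Variables (n : nat) (X : 'I_n -> M).

(* With letters numbered from 0, the word b_l X_l b_{l+1} ... X_{h-1} b_h. *)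
Definition word (b : nat -> M) (ix : nat -> 'I_n) (l h : nat) : M :=
  b l * \prod_(l <= j < h) (X (ix j) * b j.+1).

Definition conjugate_equations (B : set M) (J : 'I_n -> K) : Prop :=
  forall (m : nat) (b : nat -> M) (i : 'I_n) (ix : nat -> 'I_n),
    (forall j, (j <= m)%N -> B (b j)) ->
    L2_tau tau iota (L2_mulr iota (J i) (word b ix 0 m)) =
    \sum_(0 <= r < m) (i == ix r)%:R *
       (tau (word b ix 0 r) * tau (word b ix r.+1 m)).

(* A symbol a in {X_1, ..., X_n} u B, its value in M, and delta_{a, X_i}. *)
Definition symbol : Type := ('I_n + M)%type.

Definition symbol_ok (B : set M) (a : symbol) : Prop :=
  if a is inr b then B b else True.

Definition symbol_val (a : symbol) : M :=
  match a with inl j => X j | inr b => b end.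

Definition symbol_delta (a : symbol) (i : 'I_n) : R[i] :=
  if a is inl j then (j == i)%:R else 0.

Definition cumulant_equations (B D : set M) (E : M -> M) (J : 'I_n -> K) :
    Prop :=
  let kappa := L2_cumulant iota E in
  [/\ forall i, kappa (J i) [::] = 0,
      forall i d a, D d -> symbol_ok B a ->
        kappa (J i) [:: d * symbol_val a] =
        iota ((symbol_delta a i * tau d) *: 1)
    & forall i (w : seq (M * symbol)), (2 <= size w)%N ->
        (forall da, da \in w -> D da.1 /\ symbol_ok B da.2) ->
        kappa (J i) [seq da.1 * symbol_val da.2 | da <- w] = 0].

End Equations.

(* Main.v *)
Require Import Defs.
From HB Require Import structures.
From mathcomp Require Import all_boot all_order all_algebra.
From mathcomp Require Import zify ring.
From mathcomp Require Import complex.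
From mathcomp Require Import boolp classical_sets topology normedtype reals.
Set Implicit Arguments.
Unset Strict Implicit.
Unset Printing Implicit Defensive.
Import Order.TTheory GRing.Theory Num.Theory.
Import numFieldNormedType.Exports.
Local Open Scope classical_set_scope.
Local Open Scope complex_scope.
Local Open Scope ring_scope.

(* Let x_j = d_j a_j d_j' with d_j, d_j' in D and a_j in {X_1, ..., X_n} u B.
   Testing against D, the conjugate equations for J = J_i say that
     E(J d x_1 ... x_m) = sum_r delta_{a_r, X_i} tau(d x_1 ... x_{r-1} d_r)
                                     d_r' E(x_{r+1} ... x_m)          (M)
   for all m, and the cumulant equations that kappa(J d, x_1, ..., x_m) is
   delta_{a_1, X_i} tau(d d_1) d_1' for m = 1 and 0 otherwise (C).  By induction
   on m, (M) and (C) are equivalent: if (C) holds for shorter words, only the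
   partitions whose first block is some {J, x_r} contribute to
     E(J d x_1 ... x_m) - kappa(J d, x_1, ..., x_m)
   (m >= 2), and the sum over the partitions of the two gaps of such a block
   yields the term of index r in (M).  Stating (C) with coefficients on both
   sides of the a_j makes the D-balancedness and the additivity of the cumulants
   unnecessary. *)

(** * Noncrossing partitions *)

Section NoncrossingPartitions.
Local Open Scope nat_scope.

(** The crossing condition ends in an equality of blocks, so that it applies to blocks not yet known
    to be distinct. *)
Lemma noncrossingP n (p : {set {set 'I_n}}) :
  reflect
    [/\ finset.set0 \notin p,
        forall x, exists2 V : {set 'I_n}, V \in p & x \in V,
        forall (V W : {set 'I_n}) x,
          V \in p -> W \in p -> x \in V -> x \in W -> V = W
      & forall (V W : {set 'I_n}) (a b c d : 'I_n), V \in p -> W \in p ->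
          a \in V -> b \in W -> c \in V -> d \in W ->
          a < b -> b < c -> c < d -> V = W]
    (noncrossing p).
Proof.
apply: (iffP andP) => [[/and3P[/eqP cp tp n0] nc]|[n0 cp dp nc]].
  split=> // [x|V W x Vp Wp xV xW|V W a b c d Vp Wp aV bW cV dW ab bc cd].
  - exists (finset.pblock p x);
    rewrite ?finset.pblock_mem ?finset.mem_pblock //;
    by rewrite cp inE.
  - by rewrite -(finset.def_pblock tp Vp xV) (finset.def_pblock tp Wp xW).
  - apply/eqP; apply: contraT => VW.
    move/forall_inP: nc => /(_ V Vp)/forall_inP/(_ W Wp); rewrite VW /=.
    case/negP; apply/exists_inP; exists a => //; apply/exists_inP;
      exists b => //.
    by apply/exists_inP; exists c => //; apply/exists_inP; exists d;
      rewrite ?ab ?bc.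
split.
  apply/and3P; split=> //.
  - apply/eqP/setP => x; rewrite inE; apply/finset.bigcupP.
    by have [V Vp xV] := cp x; exists V.
  - apply/finset.trivIsetP => V W Vp Wp;
    apply: contraNT => /pred0Pn[x /andP[xV xW]].
    by apply/eqP/(dp _ _ x).
apply/forall_inP => V Vp; apply/forall_inP => W Wp; apply/implyP.
apply: contraNN => /exists_inP[a aV /exists_inP[b bW /exists_inP[c cV]]].
by case/exists_inP=> d dW /and3P[ab bc cd]; apply/eqP/(nc _ _ a b c d).
Qed.

Lemma noncrossing_pblock n (p : {set {set 'I_n}}) (V : {set 'I_n}) x :
  noncrossing p -> V \in p -> x \in V -> finset.pblock p x = V.
Proof. by case/andP=> /and3P[_ tp _] _; apply: finset.def_pblock. Qed.

Lemma noncrossing_pblock_mem n (p : {set {set 'I_n}}) x :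
  noncrossing p -> (finset.pblock p x \in p) * (x \in finset.pblock p x).
Proof.
case/andP=> /and3P[/eqP cp _ _] _.
by rewrite finset.mem_pblock finset.pblock_mem cp ?inE.
Qed.

End NoncrossingPartitions.

(* The noncrossing partitions in which the block of the least element 0 is
   {0, r} correspond to the pairs of noncrossing partitions of the two gaps
   0 < l < r and r < l. *)
Section TwoElementBlock.
Local Open Scope nat_scope.
Variables (a b : nat).
Let N := (a + b).+2.
Implicit Types (p : {set {set 'I_N}}) (u : {set {set 'I_a}})
  (v : {set {set 'I_b}}).

(** The labels are laid out as 0, then the first gap 1, ..., a, then the partner a + 1 of 0, then
    the second gap a + 2, ..., a + b + 1. All these values are below N, so [inord] never falls back
    on its default. *)
Definition gap1 (j : 'I_a) : 'I_N := inord j.+1.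
Definition gap2 (j : 'I_b) : 'I_N := inord (a.+2 + j).
Definition pair_end : 'I_N := inord a.+1.
Definition pair_block : {set 'I_N} := [set ord0; pair_end]%SET.

Lemma gap1E j : gap1 j = j.+1 :> nat.
Proof. by rewrite inordK // /N; have := ltn_ord j; lia. Qed.
Lemma gap2E j : gap2 j = a.+2 + j :> nat.
Proof. by rewrite inordK // /N; have := ltn_ord j; lia. Qed.
Lemma pair_endE : pair_end = a.+1 :> nat.
Proof. by rewrite inordK // /N; lia. Qed.

Lemma gap1_inj : injective gap1.
Proof. by move=> i j /(congr1 val); rewrite /= !gap1E => -[/val_inj]. Qed.
Lemma gap2_inj : injective gap2.
Proof. by move=> i j /(congr1 val); rewrite /= !gap2E => /addnI/val_inj. Qed.

Variant pair_gap_spec : 'I_N -> Type :=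
| PairBlock x of x \in pair_block : pair_gap_spec x
| PairGap1 j : pair_gap_spec (gap1 j)
| PairGap2 j : pair_gap_spec (gap2 j).

Lemma pair_gapP x : pair_gap_spec x.
Proof.
have [xV|xV] := boolP (x \in pair_block); first exact: PairBlock.
have [x0 xr] : x != 0 :> nat /\ x != a.+1 :> nat.
  move: xV; rewrite !inE negb_or => /andP[/eqP x0 /eqP xr].
  by split; apply/eqP => xE; [apply: x0|apply: xr]; apply/val_inj;
    rewrite //= pair_endE.
have xN : x < (a + b).+2 := ltn_ord x.
have [xa|xa] := ltnP x a.+1.
  have j1 : x.-1 < a by lia.
  suff -> : x = gap1 (Ordinal j1) by constructor.
  by apply/val_inj; rewrite /= gap1E /=; lia.
have j2 : x - a.+2 < b by lia.
suff -> : x = gap2 (Ordinal j2) by constructor.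
by apply/val_inj; rewrite /= gap2E /=; lia.
Qed.

Lemma gap1_pair j : gap1 j \notin pair_block.
Proof.
rewrite !inE negb_or -!val_eqE /= gap1E pair_endE /=.
by have := ltn_ord j; lia.
Qed.
Lemma gap2_pair j : gap2 j \notin pair_block.
Proof. by rewrite !inE negb_or -!val_eqE /= gap2E pair_endE /=; lia. Qed.
Lemma gap12 i j : gap1 i != gap2 j.
Proof. by rewrite -val_eqE /= gap1E gap2E; have := ltn_ord i; lia. Qed.

Definition pair_join (q : {set {set 'I_a}} * {set {set 'I_b}}) :
    {set {set 'I_N}} :=
  (pair_block |: ([set gap1 @: (V : {set _}) | V in q.1] :|:
                  [set gap2 @: (V : {set _}) | V in q.2]))%SET.

(** Only the blocks contained in one gap are kept, pulled back to the labels of that gap; by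
    [pair_splitP], for a noncrossing p with the prescribed block of 0, the pair alone is dropped. *)
Definition pair_split p : {set {set 'I_a}} * {set {set 'I_b}} :=
  ([set V : {set 'I_a} | (gap1 @: V)%SET \in p]%SET,
   [set V : {set 'I_b} | (gap2 @: V)%SET \in p]%SET).

Variant pair_join_spec u v : {set 'I_N} -> Prop :=
| JoinPair : pair_join_spec u v pair_block
| JoinGau V of V \in u : pair_join_spec u v (gap1 @: V)%SET
| JoinGav V of V \in v : pair_join_spec u v (gap2 @: V)%SET.

Lemma pair_joinP u v W : W \in pair_join (u, v) -> pair_join_spec u v W.
Proof.
move=> Wp.
have [->|WP] := eqVneq W pair_block; first by constructor.
have [W1|W1] := boolP (W \in [set gap1 @: (V : {set _}) | V in u]%SET).
  by have [/= V Vu ->] := finset.imsetP W1; constructor.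
have [W2|W2] := boolP (W \in [set gap2 @: (V : {set _}) | V in v]%SET).
  by have [/= V Vv ->] := finset.imsetP W2; constructor.
by move: Wp; rewrite !inE (negPf WP) (negPf W1) (negPf W2).
Qed.

Lemma mem_join_pair u v : pair_block \in pair_join (u, v).
Proof. by rewrite !inE eqxx. Qed.

Lemma mem_join1 u v V : V \in u -> (gap1 @: V)%SET \in pair_join (u, v).
Proof. by move=> Vu; rewrite !inE finset.imset_f ?orbT. Qed.

Lemma mem_join2 u v V : V \in v -> (gap2 @: V)%SET \in pair_join (u, v).
Proof. by move=> Vv; rewrite !inE [X in _ || (_ || X)]finset.imset_f ?orbT. Qed.

Lemma mem_gap1 (V : {set 'I_a}) j : (gap1 j \in (gap1 @: V)%SET) = (j \in V).
Proof. exact: (finset.mem_imset _ _ gap1_inj). Qed.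
Lemma mem_gap2 (V : {set 'I_b}) j : (gap2 j \in (gap2 @: V)%SET) = (j \in V).
Proof. exact: (finset.mem_imset _ _ gap2_inj). Qed.
Lemma mem_gap12 (V : {set 'I_b}) j : (gap1 j \in (gap2 @: V)%SET) = false.
Proof.
by apply/finset.imsetP => -[i _ /eqP]; rewrite (negPf (gap12 j i)).
Qed.
Lemma mem_gap21 (V : {set 'I_a}) j : (gap2 j \in (gap1 @: V)%SET) = false.
Proof.
by apply/finset.imsetP => -[i _ /eqP]; rewrite eq_sym (negPf (gap12 i j)).
Qed.
Lemma mem_pair1 (V : {set 'I_a}) x :
  x \in pair_block -> (x \in (gap1 @: V)%SET) = false.
Proof.
by move=> xP; apply/finset.imsetP => -[i _ xE]; move: xP;
  rewrite xE (negPf (gap1_pair i)).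
Qed.
Lemma mem_pair2 (V : {set 'I_b}) x :
  x \in pair_block -> (x \in (gap2 @: V)%SET) = false.
Proof.
by move=> xP; apply/finset.imsetP => -[i _ xE]; move: xP;
  rewrite xE (negPf (gap2_pair i)).
Qed.

(** The empty set has the same image under both embeddings, so an empty block of one component would
    reappear in the other; nonempty images from different gaps are distinct. *)
Lemma pair_joinK u v : finset.set0 \notin u -> finset.set0 \notin v ->
  pair_split (pair_join (u, v)) = (u, v).
Proof.
move=> u0 v0.
have ord0P : ord0 \in pair_block by rewrite !inE eqxx.
congr pair; apply/setP => V; rewrite inE; apply/idP/idP;
  [|exact: mem_join1| |exact: mem_join2].
  move/pair_joinP; move E: (gap1 @: V)%SET => W0 WP;
    case: {W0} WP E => [|W Wu|W Wv] E.
  - by have := mem_pair1 V ord0P; rewrite E ord0P.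
  - by rewrite (finset.imset_inj gap1_inj E).
  - have /finset.set0Pn[x xW] : W != finset.set0 by apply: contraNneq v0 => <-.
    by have := mem_gap21 V x; rewrite E mem_gap2 xW.
move/pair_joinP; move E: (gap2 @: V)%SET => W0 WP;
  case: {W0} WP E => [|W Wu|W Wv] E.
- by have := mem_pair2 V ord0P; rewrite E ord0P.
- have /finset.set0Pn[x xW] : W != finset.set0 by apply: contraNneq u0 => <-.
  by have := mem_gap12 V x; rewrite E mem_gap1 xW.
- by rewrite (finset.imset_inj gap2_inj E).
Qed.

(** The first gap lies between the two elements of the pair and the second gap lies after both, so
    blocks of different origin cannot cross; inside a gap the embedding is increasing. *)
Lemma noncrossing_join u v : noncrossing u -> noncrossing v ->
  noncrossing (pair_join (u, v)).
Proof.
move=> /noncrossingP[u0 cu du nu] /noncrossingP[v0 cv dv nv].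
have mem1 (V : {set 'I_a}) x : x \in (gap1 @: V)%SET ->
    exists2 j, j \in V & x = gap1 j by case/finset.imsetP => j; exists j.
have mem2 (V : {set 'I_b}) x : x \in (gap2 @: V)%SET ->
    exists2 j, j \in V & x = gap2 j by case/finset.imsetP => j; exists j.
have memP x : x \in pair_block -> x = 0 :> nat \/ x = a.+1 :> nat.
  by rewrite !inE => /orP[]/eqP->; [left|right; rewrite pair_endE].
apply/noncrossingP; split.
- apply/negP => /pair_joinP; move E: finset.set0 => W0 WP;
  case: {W0} WP E => [|W Wu|W Wv] E.
  + by have := finset.in_set0 (ord0 : 'I_N); rewrite E !inE eqxx.
  + by case/negP: u0; rewrite (_ : finset.set0 = W) //; apply/esym/eqP;
    rewrite -(finset.imset_eq0 gap1) E.
  + by case/negP: v0; rewrite (_ : finset.set0 = W) //; apply/esym/eqP;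
    rewrite -(finset.imset_eq0 gap2) E.
- move=> x; case: (pair_gapP x) => [{}x xP|j|j].
  + by exists pair_block; rewrite ?mem_join_pair.
  + by have [V Vu jV] := cu j; exists (gap1 @: V)%SET;
    rewrite ?mem_join1 ?mem_gap1.
  + by have [V Vv jV] := cv j; exists (gap2 @: V)%SET;
    rewrite ?mem_join2 ?mem_gap2.
- move=> V W x Vp Wp; case: (pair_gapP x) => [{}x xP|j|j].
  + case: _ / (pair_joinP Vp) => [|V' _|V' _];
    rewrite ?(mem_pair1 _ xP) ?(mem_pair2 _ xP) // => _.
    by case: _ / (pair_joinP Wp) => [|W' _|W' _];
      rewrite ?(mem_pair1 _ xP) ?(mem_pair2 _ xP).
  + case: _ / (pair_joinP Vp) => [|V' V'u|V' _];
    rewrite ?mem_gap12 ?(negPf (gap1_pair _)) // mem_gap1 => jV.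
    case: _ / (pair_joinP Wp) => [|W' W'u|W' _];
      rewrite ?mem_gap12 ?(negPf (gap1_pair _)) // mem_gap1 => jW.
    by rewrite (du _ _ _ V'u W'u jV jW).
  + case: _ / (pair_joinP Vp) => [|V' _|V' V'v];
    rewrite ?mem_gap21 ?(negPf (gap2_pair _)) // mem_gap2 => jV.
    case: _ / (pair_joinP Wp) => [|W' _|W' W'v];
      rewrite ?mem_gap21 ?(negPf (gap2_pair _)) // mem_gap2 => jW.
    by rewrite (dv _ _ _ V'v W'v jV jW).
- move=> V W x1 x2 x3 x4 Vp Wp.
  case: _ / (pair_joinP Vp) => [|V' V'u|V' V'v];
    case: _ / (pair_joinP Wp) => [|W' W'u|W' W'v] //.
  + by move=> _ /mem1[j2 _ ->] /memP[] + /mem1[j4 _ ->]; rewrite !gap1E;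
    have := ltn_ord j4; lia.
  + by move=> /memP[]+ /mem2[j2 _ ->] /memP[] + _; rewrite gap2E; lia.
  + by move=> /mem1[j1 _ ->] /memP[]+ /mem1[j3 _ ->] /memP[]+; rewrite !gap1E;
    have := ltn_ord j3; lia.
  + move=> /mem1[j1 j1V ->] /mem1[j2 j2V ->] /mem1[j3 j3V ->] /mem1[j4 j4V ->].
    by rewrite !gap1E !ltnS => *;
      rewrite (nu _ _ _ _ _ _ V'u W'u j1V j2V j3V j4V).
  + by move=> _ /mem2[j2 _ ->] /mem1[j3 _ ->]; rewrite gap1E gap2E;
    have := ltn_ord j3; lia.
  + by move=> /mem2[j1 _ ->] /memP[]+ _ _; rewrite gap2E; lia.
  + by move=> /mem2[j1 _ ->] /mem1[j2 _ ->] _ _; rewrite gap1E gap2E;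
    have := ltn_ord j2; lia.
  + move=> /mem2[j1 j1V ->] /mem2[j2 j2V ->] /mem2[j3 j3V ->] /mem2[j4 j4V ->].
    by rewrite !gap2E !ltn_add2l => *;
      rewrite (nv _ _ _ _ _ _ V'v W'v j1V j2V j3V j4V).
Qed.

Lemma pblock_join_pair u v : noncrossing u -> noncrossing v ->
  finset.pblock (pair_join (u, v)) ord0 = pair_block.
Proof.
move=> nu nv; apply: noncrossing_pblock (noncrossing_join nu nv)
  (mem_join_pair _ _) _.
by rewrite !inE eqxx.
Qed.

Lemma pblock_join1 u v j : noncrossing u -> noncrossing v ->
  finset.pblock (pair_join (u, v)) (gap1 j) = (gap1 @: finset.pblock u j)%SET.
Proof.
move=> nu nv; apply: noncrossing_pblock (noncrossing_join nu nv)
  (mem_join1 _ _) _;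
by rewrite ?mem_gap1 noncrossing_pblock_mem.
Qed.

Lemma pblock_join2 u v j : noncrossing u -> noncrossing v ->
  finset.pblock (pair_join (u, v)) (gap2 j) = (gap2 @: finset.pblock v j)%SET.
Proof.
move=> nu nv; apply: noncrossing_pblock (noncrossing_join nu nv)
  (mem_join2 _ _) _;
by rewrite ?mem_gap2 noncrossing_pblock_mem.
Qed.

Section Split.
Variable p : {set {set 'I_N}}.
Hypotheses (ncp : noncrossing p) (p0 : finset.pblock p ord0 = pair_block).

Let pairp : pair_block \in p.
Proof. by rewrite -p0 noncrossing_pblock_mem. Qed.

Variant pair_split_spec : {set 'I_N} -> Prop :=
| SplitPair : pair_split_spec pair_block
| SplitGap1 (V : {set 'I_a}) : pair_split_spec (gap1 @: V)%SET
| SplitGap2 (V : {set 'I_b}) : pair_split_spec (gap2 @: V)%SET.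

(** A block meeting both gaps would cross the pair: 0 < [gap1 j] < [pair_end] < [gap2 i]. *)
Lemma pair_splitP W : W \in p -> pair_split_spec W.
Proof.
case/noncrossingP: ncp => n0 cp dp nc Wp.
have [->|WP] := eqVneq W pair_block; first by constructor.
have WPx x : x \in W -> x \notin pair_block.
  by move=> xW; apply: contra WP => xP; apply/eqP; apply: (dp _ _ x).
have [/existsP[j jW]|/existsPn W1] := boolP [exists j, gap1 j \in W].
  suff -> : W = (gap1 @: (gap1 @^-1: W))%SET by constructor.
  apply/setP => x; case: (pair_gapP x) => [{}x xP|i|i].
  - by rewrite mem_pair1 //; apply: contraTF xP; apply: WPx.
  - by rewrite mem_gap1 inE.
  - rewrite mem_gap21; apply: contraNF WP => iW.
    apply/eqP/esym/(nc _ _ ord0 (gap1 j) pair_end (gap2 i)) => //.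
    all: rewrite ?inE ?eqxx ?orbT ?gap1E ?gap2E ?pair_endE //=.
    by have := ltn_ord j; lia.
    by lia.
suff -> : W = (gap2 @: (gap2 @^-1: W))%SET by constructor.
apply/setP => x; case: (pair_gapP x) => [{}x xP|i|i].
- by rewrite mem_pair2 //; apply: contraTF xP; apply: WPx.
- by rewrite mem_gap12; apply/negbTE.
- by rewrite mem_gap2 inE.
Qed.

Lemma pair_splitK : pair_join (pair_split p) = p.
Proof.
apply/setP => W; apply/idP/idP => [/pair_joinP|Wp].
  by case=> // V; rewrite inE.
case: _ / (pair_splitP Wp) (Wp) => [|V|V] Vp; first exact: mem_join_pair.
- by apply: mem_join1; rewrite inE.
- by apply: mem_join2; rewrite inE.
Qed.

Lemma noncrossing_split :
  noncrossing (pair_split p).1 /\ noncrossing (pair_split p).2.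
Proof.
case/noncrossingP: (ncp) => n0 cp dp nc; split; apply/noncrossingP;
  split => [|x|V W x|V W i j k l].
- by rewrite inE finset.imset0.
- have [W Wp] := cp (gap1 x); case: _ / (pair_splitP Wp) (Wp) => [|V|V] Vp.
  + by rewrite (negPf (gap1_pair _)).
  + by rewrite mem_gap1 => xV; exists V; rewrite ?inE.
  + by rewrite mem_gap12.
- rewrite !inE => Vp Wp xV xW; apply: (finset.imset_inj gap1_inj).
  by apply: (dp _ _ (gap1 x)); rewrite ?mem_gap1.
- rewrite !inE => Vp Wp iV jW kV lW ij jk kl;
  apply: (finset.imset_inj gap1_inj).
  by apply: (nc _ _ (gap1 i) (gap1 j) (gap1 k) (gap1 l));
    rewrite ?mem_gap1 ?gap1E.
- by rewrite inE finset.imset0.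
- have [W Wp] := cp (gap2 x); case: _ / (pair_splitP Wp) (Wp) => [|V|V] Vp.
  + by rewrite (negPf (gap2_pair _)).
  + by rewrite mem_gap21.
  + by rewrite mem_gap2 => xV; exists V; rewrite ?inE.
- rewrite !inE => Vp Wp xV xW; apply: (finset.imset_inj gap2_inj).
  by apply: (dp _ _ (gap2 x)); rewrite ?mem_gap2.
- rewrite !inE => Vp Wp iV jW kV lW ij jk kl;
  apply: (finset.imset_inj gap2_inj).
  by apply: (nc _ _ (gap2 i) (gap2 j) (gap2 k) (gap2 l));
    rewrite ?mem_gap2 ?gap2E ?ltn_add2l.
Qed.
End Split.

Lemma big_pair_block (T : nmodType) (F : {set {set 'I_N}} -> T) :
  (\sum_(p | noncrossing p && (finset.pblock p ord0 == pair_block)) F p =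
   \sum_(u | noncrossing u) \sum_(v | noncrossing v) F (pair_join (u, v)))%R.
Proof.
rewrite pair_big (reindex_onto pair_join pair_split) /=; last first.
  by move=> p /andP[ncp /eqP]; apply: pair_splitK.
apply: eq_bigl => -[u v] /=; apply/idP/idP.
  case/andP=> /andP[ncp /eqP/(noncrossing_split ncp)[nu nv] /eqP uvE].
  by rewrite uvE in nu nv; rewrite nu nv.
case/andP=> nu nv; rewrite noncrossing_join // pblock_join_pair // eqxx.
have [[u0 _ _ _] [v0 _ _ _]] := (noncrossingP _ nu, noncrossingP _ nv).
by rewrite pair_joinK // eqxx.
Qed.
End TwoElementBlock.

(** * Removal of the blocks of a gap *)

(** Two strictly increasing lists with the same elements coincide. *)
Lemma enum_imset_mono n N (f : 'I_n -> 'I_N) (W : {set 'I_n}) :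
  {mono f : i j / (i < j)%N} ->
  enum (f @: W)%SET = [seq f j | j <- enum W].
Proof.
move=> fmono.
have ltI k : irreflexive (fun i j : 'I_k => (i < j)%N) by move=> i;
  rewrite ltnn.
have ltT k : transitive (fun i j : 'I_k => (i < j)%N).
  by move=> j i l; apply: ltn_trans.
have sorted_enum k (V : {set 'I_k}) :
    sorted (fun i j : 'I_k => (i < j)%N) (enum V).
  rewrite /enum_mem -enumT; apply: sorted_filter => //.
  by have := iota_ltn_sorted 0 k; rewrite -val_enum_ord sorted_map.
apply: (irr_sorted_eq (ltT N) (ltI N)); first exact: sorted_enum.
- by rewrite sorted_map (eq_sorted (e' := fun i j : 'I_n => (i < j)%N)).
- move=> x; rewrite mem_enum; apply/finset.imsetP/mapP => -[j jW ->];
  exists j => //;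
  by rewrite ?mem_enum // -mem_enum.
Qed.

Lemma enum_ord0_mem n (W : {set 'I_n.+1}) : ord0 \in W ->
  enum W = ord0 :: [seq lift ord0 i | i <- enum 'I_n & lift ord0 i \in W].
Proof.
move=> W0; rewrite {1}/enum_mem -enumT enum_ordSl /= filter_map.
rewrite ifT //.
Qed.

Lemma map_val_enum n N (f : 'I_n -> 'I_N) k :
  (forall j, f j = (k + j)%N :> nat) ->
  map val [seq f j | j <- enum 'I_n] = iota k n.
Proof.
move=> fE; rewrite -map_comp.
have /eq_map -> : val \o f =1 addn k \o val by move=> j; exact: fE.
by rewrite (map_comp (addn k)) val_enum_ord -iotaDl addn0.
Qed.

Section RemoveBlocks.
Variables (A : pzRingType) (E : A -> A).
Let kA := uncons_cumulant (cumulant E).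

Lemma remove_blockE n (p : {set {set 'I_n.+1}}) i m j :
  remove_block kA p i m j =
  if [&& i != ord0, block_min p i & j.+1 == i :> nat]
  then m j * kA [seq m l | l <- enum (finset.pblock p i)] else m j.
Proof. by rewrite /remove_block; case: (_ != _); case: (block_min p i). Qed.

(** The factor that a partitioned gap contributes to its left neighbour. The first letter of the gap
    plays the role of the distinguished first argument; an empty gap contributes 1. *)
Definition gap_value (s : seq A) : {set {set 'I_(size s)}} -> A :=
  if s is x :: t return {set {set 'I_(size s)}} -> A then
    partition_cumulant *%R kA (cumulant E) x (s := t)
  else fun=> 1.

(** This is the moment-cumulant formula, except for the empty word, where the empty partition is the
    only one and [E 1 = 1] is used. *)
Lemma sum_gap_value (s : seq A) : E 1 = 1 ->
  \sum_(p : {set {set 'I_(size s)}} | noncrossing p) gap_value p =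
    E (\prod_(x <- s) x).
Proof.
move=> E1; case: s => [|x t]; last by rewrite big_cons moment_cumulant.
rewrite big_nil E1 (big_pred1 finset.set0) //= => p; apply/idP/eqP => [|->].
  case/noncrossingP => p0 _ _ _; apply/setP => V; rewrite finset.in_set0.
  apply: contraNF p0 => Vp; rewrite (_ : finset.set0 = V) //.
  by apply/setP => -[].
by apply/noncrossingP; split => [|[]|V W []|V W []] //; rewrite finset.in_set0.
Qed.

(** Removing blocks of P along [f] imitates removing blocks of p. The block of the first letter of
    the gap goes last, and its cumulant, which is the value of the whole gap, is passed to the left
    neighbour [e]. *)
Lemma fold_remove_gap N (s : seq A) (f : 'I_(size s) -> 'I_N.+1)
    (e : 'I_N.+1) (P : {set {set 'I_N.+1}}) (p : {set {set 'I_(size s)}})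
    (m : 'I_N.+1 -> A) :
  (forall j, f j = (e + j).+1 :> nat) -> noncrossing p ->
  (forall j, finset.pblock P (f j) = (f @: finset.pblock p j)%SET) ->
  (forall j, m (f j) = nth 1 s j) ->
  let m' := foldr (remove_block kA P) m [seq f j | j <- enum 'I_(size s)] in
  m' e = m e * gap_value p /\
  forall i, i \notin codom f -> i != e -> m' i = m i.
Proof.
case: s f p => [|x t] f p fE ncp Pf mf.
  by rewrite (_ : enum _ = [::]) /= ?mulr1 //; apply: size0nil;
    rewrite size_enum_ord.
have finj : injective f.
  by move=> i j /(congr1 val) /=; rewrite !fE => -[] /addnI/val_inj.
have fmono : {mono f : i j / (i < j)%N} by move=> i j;
  rewrite !fE ltnS ltn_add2l.
have fle i j : (f i <= f j)%N = (i <= j)%N by rewrite !fE ltnS leq_add2l.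
have fn0 j : f j != ord0 by rewrite -val_eqE /= fE.
have bmin j : block_min P (f j) = block_min p j.
  apply/forall_inP/forall_inP => H i; rewrite ?Pf.
    by move=> ip; rewrite -fle; apply: H; rewrite Pf finset.imset_f.
  by case/finset.imsetP=> k kp ->; rewrite fle; apply: H.
set m0 : 'I_(size t).+1 -> A := fun j => nth 1 (1 :: t) j.
(* As long as the block of the first letter stays, the two families agree along [f], except that
   [partition_cumulant] keeps [x] apart and starts entry 0 at 1. *)
have step (l : seq 'I_(size t).+1) : ord0 \notin l ->
    let m1 := foldr (remove_block kA P) m (map f l) in
    let m2 := foldr (remove_block kA p) m0 l in
    (forall j, m1 (f j) = if j == ord0 then x * m2 j else m2 j) /\
    (forall i, i \notin codom f -> m1 i = m i).
  elim: l => [|j l IH] /=.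
    move=> _; split=> // j; rewrite mf /m0.
    by case: j => -[|j] jt //=; rewrite mulr1.
  rewrite inE negb_or eq_sym => /andP[j0 /IH[IH1 IH2]] {IH}.
  (* A block whose least label is j, with j nonzero, does not contain 0, so none of its entries
     carries the extra factor [x]. *)
  have vE : block_min p j ->
      [seq foldr (remove_block kA P) m [seq f i | i <- l] i
        | i <- enum (finset.pblock P (f j))] =
      [seq foldr (remove_block kA p) m0 l i | i <- enum (finset.pblock p j)].
    move=> jmin.
    rewrite Pf enum_imset_mono // -map_comp; apply/eq_in_map => i /=.
    rewrite mem_enum IH1; case: eqP => // -> jp.
    move/forall_inP: jmin => /(_ _ jp); rewrite leqn0 => /eqP j0'.
    by case/eqP: j0; apply/val_inj.
  split=> [i|i fi]; rewrite !remove_blockE fn0 bmin /=.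
    rewrite j0 !fE eqSS -addnS eqn_add2l IH1;
      case: (boolP (block_min p j)) => //= jmin.
    by rewrite vE //; do 2?case: ifP => _ //; rewrite mulrA.
  case: (boolP (block_min p j)) => /= jmin; last exact: IH2.
  case: eqP => [iE|_]; last exact: IH2.
  (* The entry multiplied here is the left neighbour of [f j]; as j is nonzero it is the image of j
     - 1 and lies in the gap. *)
  case/negP: fi; apply/codomP;
    have j1 : (j.-1 < (size t).+1)%N by have := ltn_ord j; lia.
  exists (Ordinal j1); apply/val_inj; move: iE; rewrite /= !fE /=.
  have : val j != 0%N by apply: contra j0 => /eqP j0; apply/eqP/val_inj.
  by rewrite /=; lia.
have en0 : ord0 \notin [seq lift ord0 i | i <- enum 'I_(size t)].
  by apply/mapP => -[i _ /eqP]; rewrite (negPf (neq_lift _ _)).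
rewrite enum_ordSl /=; have [H1 H2] := step _ en0.
set m1 := foldr _ m _ in H1 H2 *; set m2 := foldr _ m0 _ in H1.
have m1e : m1 e = m e.
  by apply: H2; apply/codomP => -[j] /(congr1 val) /=; rewrite fE; lia.
rewrite /remove_block fn0 bmin fE /= addn0.
rewrite (_ : block_min p ord0) ?eqxx; last by apply/forall_inP.
have pm2 : remove_blocks kA p m0 = m2.
  by rewrite /remove_blocks enum_ordSl /= /remove_block eqxx.
split=> [|i fi ie]; last by rewrite eqSS (negPf (_ : i != e :> nat)) ?H2.
rewrite m1e Pf enum_imset_mono // -map_comp; congr (_ * _).
rewrite /partition_cumulant -/m0 pm2.
rewrite (enum_ord0_mem (noncrossing_pblock_mem ord0 ncp).2) /= H1 eqxx.
congr cumulant; rewrite -!map_comp; apply/eq_map => i /=.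
by rewrite H1 eq_sym (negPf (neq_lift _ _)).
Qed.

(** Labels are treated in decreasing order: the second gap is absorbed by the letter [y] at [r],
    then the first gap by entry 0, which starts at 1. Hence the sum over partitions factors through
    the two gaps. *)
Lemma sum_pair_block n (s1 s2 : seq A) (y : A) (m : 'I_n.+1 -> A)
    (r : 'I_n.+1) (T : nmodType) (F : A -> A -> T) :
  n = (size s1 + size s2).+1 ->
  (forall j, m j = nth 1 (1 :: s1 ++ y :: s2) j) ->
  r = (size s1).+1 :> nat ->
  \sum_(p | noncrossing p && (finset.pblock p ord0 == [set ord0; r]%SET))
     F (remove_blocks kA p m ord0) (remove_blocks kA p m r) =
  \sum_(u : {set {set 'I_(size s1)}} | noncrossing u)
    \sum_(v : {set {set 'I_(size s2)}} | noncrossing v)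
      F (gap_value u) (y * gap_value v).
Proof.
move=> nE; subst n => mE rE.
have {rE} -> : r = pair_end _ _ by apply/val_inj; rewrite /= pair_endE.
rewrite big_pair_block; apply: eq_bigr => u nu; apply: eq_bigr => v nv.
set p := pair_join (u, v); set e := pair_end _ _.
pose g1 := @gap1 (size s1) (size s2); pose g2 := @gap2 (size s1) (size s2).
have enumE : enum 'I_(size s1 + size s2).+2 =
    ord0 :: [seq g1 j | j <- enum 'I_(size s1)] ++
      e :: [seq g2 j | j <- enum 'I_(size s2)].
  apply: (inj_map val_inj); rewrite val_enum_ord map_cons map_cat map_cons.
  rewrite (@map_val_enum _ _ g1 1) => [|k]; last by rewrite gap1E.
  rewrite (@map_val_enum _ _ g2 (size s1).+2) => [|k]; last by rewrite gap2E.
  by rewrite [val e]pair_endE -addnS -[iota _ _]/(0%N :: iota 1 _) iotaD.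
have g1E j : g1 j = (@ord0 (size s1 + size s2).+1 + j).+1 :> nat
  by rewrite gap1E.
have g2E j : g2 j = (e + j).+1 :> nat by rewrite gap2E pair_endE.
have m1 j : m (g1 j) = nth 1 s1 j by rewrite mE gap1E /= nth_cat ltn_ord.
have m2 j : m (g2 j) = nth 1 s2 j.
  by rewrite mE gap2E addSn /= nth_cat ltnNge ltnW ?ltnS ?leq_addr // addSn
    subSn ?leq_addr // addKn.
have me : m e = y by rewrite mE pair_endE /= nth_cat ltnn subnn.
have e0 : e != ord0 by rewrite -val_eqE /= pair_endE.
have eg1 : e \notin codom g1.
  by apply/codomP => -[j eE]; have := gap1_pair (size s2) j;
    rewrite -/g1 -eE !inE eqxx orbT.
have og1 : ord0 \notin codom g1.
  by apply/codomP => -[j eE]; have := gap1_pair (size s2) j;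
    rewrite -/g1 -eE !inE eqxx.
have og2 : ord0 \notin codom g2.
  by apply/codomP => -[j eE]; have := gap2_pair (size s1) j;
    rewrite -/g2 -eE !inE eqxx.
have [G2 G2'] := fold_remove_gap g2E nv (fun j => pblock_join2 j nu nv) m2.
set m' := foldr _ m _ in G2 G2'.
have m'1 j : m' (g1 j) = nth 1 s1 j.
  rewrite G2' ?m1 //; last
    by rewrite -val_eqE /= g1E pair_endE add0n eqSS neq_ltn ltn_ord.
  by apply/codomP => -[i /eqP]; rewrite (negPf (gap12 _ _)).
have [G1 G1'] := fold_remove_gap g1E nu (fun j => pblock_join1 j nu nv) m'1.
set m'' := foldr _ m' _ in G1 G1'.
suff -> : remove_blocks kA p m = m''.
  by rewrite G1 G1' // G2 G2' // 1?eq_sym // me mE mul1r.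
rewrite /remove_blocks enumE /= foldr_cat /= {1}/remove_block eqxx /=.
(* The label [e] lies in the block of 0 and is not its least element, so nothing is removed between
   the two gaps. *)
rewrite {2}/remove_block (_ : block_min p e = false) ?andbF //.
apply/negP => /forall_inP/(_ ord0).
rewrite (@noncrossing_pblock _ _ (pair_block _ _)) ?mem_join_pair
  ?noncrossing_join //.
  by rewrite !inE eqxx pair_endE => /(_ isT).
by rewrite !inE eqxx orbT.
Qed.

Section Closed.
Variable D : set A.
Hypotheses (D1 : D 1) (DB : forall a b, D a -> D b -> D (a - b))
  (DM : forall a b, D a -> D b -> D (a * b)) (DE : forall a, D (E a)).

Let D0 : D 0. Proof. by rewrite -(subrr 1); apply: DB. Qed.
Let DD a b : D a -> D b -> D (a + b).
Proof. by move=> Da Db; rewrite -(opprK b) -[- b]sub0r; apply/DB/DB. Qed.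

(** Each subtracted term is itself a cumulant, that of the block of the first argument, so induction
    on the depth reduces the claim to [E] having values in D. *)
Lemma cumulant_closed x s : D (cumulant E x s).
Proof.
rewrite /cumulant; move: (size s).+1 => f; elim: f x s => [|f IH] x s //=.
by apply: DB => //; apply: big_ind => // p _; apply: IH.
Qed.

Lemma uncons_cumulant_closed s : D (kA s).
Proof. by case: s => [|x s] //; apply: cumulant_closed. Qed.

Lemma gap_value_closed (s : seq A) (p : {set {set 'I_(size s)}}) :
  D (gap_value p).
Proof. by case: s p => [|x s] p //=; apply: cumulant_closed. Qed.

(** The removed cumulants lie in D, so a letter d a d' keeps its form: they are absorbed by its
    right coefficient. *)
Lemma remove_blocks_factor n (p : {set {set 'I_n.+1}}) m j :
  exists2 v, D v & remove_blocks kA p m j = m j * v.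
Proof.
rewrite /remove_blocks; elim: (enum _) => [|i l [v Dv IH]] /=.
  by exists 1; rewrite ?mulr1.
rewrite remove_blockE; case: ifP => _; last by exists v.
rewrite IH -mulrA; exists (v * kA [seq foldr (remove_block kA p) m l l0 | l0 <-
  enum (finset.pblock p i)]) => //.
exact/DM/uncons_cumulant_closed.
Qed.
End Closed.

(** If the block of 0 contained every label, disjointness would leave no other block. The strict
    bound is what lets induction on the word length apply to the block of 0. *)
Lemma size_pblock_lt n (p : {set {set 'I_n.+1}}) :
  noncrossing p -> p != one_block n.+1 ->
  (size (behead (enum (finset.pblock p ord0))) < n)%N.
Proof.
move=> ncp; apply: contraNT; rewrite -leqNgt size_behead -cardE => nV.
have VT : finset.pblock p ord0 = [set: 'I_n.+1]%SET.
  apply/eqP; rewrite finset.eqEcard finset.subsetT finset.cardsT card_ord.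
  have [_ V0] := noncrossing_pblock_mem ord0 ncp.
  have : (0 < #|finset.pblock p ord0|)%N by apply/card_gt0P; exists ord0.
  by lia.
have Tp : [set: 'I_n.+1]%SET \in p by rewrite -VT noncrossing_pblock_mem.
case/noncrossingP: ncp => n0 cp dp _.
apply/eqP/setP => V; rewrite inE; apply/idP/eqP => [Vp|->//].
have /finset.set0Pn[x xV] : V != finset.set0 by apply: contraNneq n0 => <-.
by apply: (dp _ _ x); rewrite ?inE.
Qed.
End RemoveBlocks.

(** * Moments and cumulants of words *)

Section Equivalence.
Variables (R : realType) (M : algType R[i]) (K : lmodType R[i]).
Variables (tau : M -> R[i]) (iota : M -> K) (act : K -> M -> K) (EL : K -> K).
Variables (E : M -> M) (B D : set M) (n : nat) (X : 'I_n -> M).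
Hypotheses (D1 : D 1) (DB : forall a b, D a -> D b -> D (a - b))
  (DM : forall a b, D a -> D b -> D (a * b)) (DE : forall a, D (E a)).
Hypothesis E1 : E 1 = 1.
Hypothesis EM : forall a m b, D a -> D b -> E (a * m * b) = a * E m * b.
Hypothesis tau_lin : forall c a b, tau (c *: a + b) = c * tau a + tau b.
Hypothesis tauE : forall m, tau (E m) = tau m.
Hypothesis iota_lin : forall c a b, iota (c *: a + b) = c *: iota a + iota b.
Hypothesis act1 : forall xi, act xi 1 = xi.
Hypothesis actM : forall xi a b, act (act xi a) b = act xi (a * b).
Hypothesis act_iota : forall m a, act (iota m) a = iota (m * a).
Hypothesis EL_act : forall xi d, D d -> EL (act xi d) = act (EL xi) d.

Notation kappa := (module_cumulant E act EL).

Definition entry : Type := (M * symbol M n * M)%type.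
Definition entry_val (e : entry) : M := e.1.1 * symbol_val X e.1.2 * e.2.
Definition entry_ok (e : entry) : Prop :=
  [/\ D e.1.1, symbol_ok B e.1.2 & D e.2].
Notation vals := (map entry_val).
Notation prod w := (\prod_(x <- vals w) x).

Variable i : 'I_n.
Notation delta a := (symbol_delta a i : R[i]).

(* The values that (C) and (M) prescribe; y stands for the letters to the left
   of w. *)
Definition expected_cumulant (d : M) (w : seq entry) : K :=
  if w is [:: e] then iota ((delta e.1.2 * tau (d * e.1.1)) *: e.2) else 0.

Fixpoint expected_moment (y : M) (w : seq entry) : M :=
  if w is e :: w' then
    (delta e.1.2 * tau (y * e.1.1)) *: (e.2 * E (prod w')) +
    expected_moment (y * entry_val e) w'
  else 0.

Let iota0 : iota 0 = 0.
Proof. by have := iota_lin (-1) 0 0; rewrite scaler0 addr0 scaleN1r addNr. Qed.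
Let iotaD a b : iota (a + b) = iota a + iota b.
Proof. by have := iota_lin 1 a b; rewrite !scale1r. Qed.
Let tau0 : tau 0 = 0.
Proof. by have := tau_lin (-1) 0 0; rewrite scaler0 addr0 mulN1r addNr. Qed.
Let tauD a b : tau (a + b) = tau a + tau b.
Proof. by have := tau_lin 1 a b; rewrite !scale1r mul1r. Qed.

Let e0 : entry := (1, inr 0, 1).

(** Unrolls the recursion: k is the position of the letter paired with the first argument, and y has
    collected the letters before it. *)
Lemma expected_momentE y w :
  expected_moment y w =
  \sum_(k < size w) (delta (nth e0 w k).1.2 *
      tau (y * prod (take k w) * (nth e0 w k).1.1)) *:
    ((nth e0 w k).2 * E (prod (drop k.+1 w))).
Proof.
elim: w y => [|e w IH] y /=; first by rewrite big_ord0.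
rewrite big_ord_recl /= drop0 big_nil mulr1 IH; congr (_ + _).
by apply: eq_bigr => k _; rewrite big_cons mulrA.
Qed.

(** The moment and the cumulant of a word differ by partitions whose first block is shorter, so its
    cumulant is known by hypothesis. Equating the two defects, rather than assuming either to be 0,
    serves both directions of the induction. *)
Lemma kappa_moment (xi : K) d (w : seq entry) : D d ->
  (forall e, e \in w -> entry_ok e) ->
  (forall d w', D d -> (forall e, e \in w' -> entry_ok e) ->
     (size w' < size w)%N ->
     kappa (act xi d) (vals w') = expected_cumulant d w') ->
  EL (act xi (d * prod w)) - iota (expected_moment d w) =
  kappa (act xi d) (vals w) - expected_cumulant d w.
Proof.
move=> Dd wok IH.
have cancel (k S m c : K) : S = m - c -> k + S - m = k - c.
  by move=> ->; rewrite addrA addrAC addrK.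
rewrite -actM (module_moment_cumulant E) //.
rewrite (bigD1 (one_block _)) ?noncrossing_one_block //= partition_cumulant_one
  act1.
(* It remains to see that the partitions other than [one_block] sum to the expected moment minus the
   expected cumulant. *)
apply: cancel.
set kA := uncons_cumulant _.
have sz : size (vals w) = size w by rewrite size_map.
set m := fun j : 'I_(size (vals w)).+1 => nth 1 (1 :: vals w) j.
have szlt k : (k < size (vals w))%N = (k < size w)%N by rewrite sz.
(* A shorter first block contributes only if exactly one letter accompanies label 0, since
   [expected_cumulant] vanishes on all other words. *)
have part0 (p : {set {set 'I_(size (vals w)).+1}}) :
  noncrossing p -> p != one_block _ ->
    size (behead (enum (finset.pblock p ord0))) != 1%N ->
    partition_cumulant act kA kappa (act xi d) p = 0.
  move=> ncp p1 szp; rewrite /partition_cumulant -/m actM.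
  (* After the removals the letters are entries again, with a larger right coefficient. Label 0
     carries no letter and receives a dummy entry. *)
  have /choice[f fP] l : exists e : entry, entry_ok e /\
      (l != ord0 -> remove_blocks kA p m l = entry_val e).
    have [v Dv ->] := remove_blocks_factor D1 DB DM DE p m l.
    have [->|l0] := eqVneq l ord0.
      by exists (1, inl i, 1); split.
    have l0' : (0 < l)%N by rewrite lt0n; apply: contra l0 => /eqP l0;
      apply/eqP/val_inj.
    have lw : (l.-1 < size w)%N by rewrite -ltnS prednK // -sz.
    have [a1 a2 a3] := wok _ (mem_nth e0 lw).
    exists ((nth e0 w l.-1).1, (nth e0 w l.-1).2 * v); split.
      by split=> //; apply: DM.
    move=> _; rewrite /m -(prednK l0') /= (nth_map e0) //.
    by rewrite /entry_val /= mulrA.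
  have [v Dv ->] := remove_blocks_factor D1 DB DM DE p m ord0.
  have := size_pblock_lt ncp p1; rewrite szlt.
  move: szp; rewrite (enum_ord0_mem (noncrossing_pblock_mem ord0 ncp).2) /=.
  set t := [seq lift ord0 _ | _ <- _ & _] => szp ltw.
  have -> : [seq remove_blocks kA p m l | l <- t] = vals [seq f l | l <- t].
    rewrite -map_comp; apply/eq_in_map => l /mapP[k _ ->] /=.
    by apply: (fP _).2; rewrite eq_sym neq_lift.
  have fok e : e \in [seq f l | l <- t] -> entry_ok e by case/mapP=> l _ ->;
    case: (fP l).
  have Ddv : D (d * (m ord0 * v)) by rewrite /m /= mul1r; apply: DM.
  have st : (size [seq f l | l <- t] < size w)%N by rewrite size_map.
  rewrite IH //.
  by case: (t) szp => [|l1 [|l2 t']] //=.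
(* For at most one letter no other partition contributes, and the two expected values agree because
   [E 1 = 1]. *)
have [w2|w2] := leqP 2 (size w); last first.
  rewrite big1 => [|p /andP[ncp p1]]; last first.
    apply: part0 => //; have := size_pblock_lt ncp p1; rewrite szlt.
    by rewrite neq_ltn => /leq_trans/(_ (w2 : (_ <= 1)%N)) ->.
  case: (w) w2 => [|e [|]] //= _; first by rewrite iota0 subrr.
  by rewrite big_nil E1 mulr1 addr0 subrr.
have -> : expected_cumulant d w = 0 by case: (w) w2 => [|? []].
rewrite subr0 expected_momentE.
pose pairb (k : 'I_(size (vals w))) : {set 'I_(size (vals w)).+1} :=
  [set ord0; lift ord0 k]%SET.
pose G (k : 'I_(size (vals w))) a b := kappa (act (act xi d) a) [:: b].
(* The inner sum has one term if the block of 0 is a pair and none otherwise; it prepares the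
   exchange of the two sums. *)
transitivity (\sum_(p | noncrossing p && (p != one_block _))
    \sum_(k | finset.pblock p ord0 == pairb k)
      G k (remove_blocks kA p m ord0) (remove_blocks kA p m (lift ord0 k))).
  apply: eq_bigr => p /andP[ncp p1].
  have [sz1|sz1] := eqVneq (size (behead (enum (finset.pblock p ord0)))) 1%N;
    last first.
    rewrite part0 // big_pred0 // => k; apply: contraNF sz1 => /eqP ->.
    by rewrite size_behead -cardE finset.cards2 neq_lift.
  have V0 := (noncrossing_pblock_mem ord0 ncp).2.
  have := enum_ord0_mem V0; case: [seq _ <- _ | _] => [|k [|? ?]] enumE;
    rewrite enumE // in sz1.
  have VE : finset.pblock p ord0 = pairb k.
    by apply/setP => x; rewrite -mem_enum enumE !inE.
  rewrite (big_pred1 k) => [|k'].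
    by rewrite /partition_cumulant -/m VE -VE enumE.
  rewrite VE; apply/eqP/eqP => [kk'|->//]; apply/esym/(@lift_inj _ ord0).
  have : lift ord0 k \in pairb k' by rewrite -kk' !inE eqxx orbT.
  by rewrite !inE eq_sym (negPf (neq_lift _ _)) => /eqP.
rewrite (exchange_big_dep xpredT) //= (big_morph iota iotaD iota0).
pose F k := iota ((delta (nth e0 w k).1.2 *
    tau (d * prod (take k w) * (nth e0 w k).1.1)) *:
  ((nth e0 w k).2 * E (prod (drop k.+1 w)))).
transitivity (\sum_(k < size (vals w)) F k); last by rewrite sz.
apply: eq_bigr => k _.
have kw : (k < size w)%N by rewrite -szlt.
(* As the word has at least two letters, a pair is not the set of all labels, so such a partition
   differs from [one_block]. *)
rewrite (eq_bigl (fun p =>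
  noncrossing p && (finset.pblock p ord0 == pairb k))); last first.
  move=> p; case: (noncrossing p) => //=; apply: andb_idl => /eqP pk.
  apply/eqP => pE; have := finset.cards2 (ord0 :
    'I_(size (vals w)).+1) (lift ord0 k).
  rewrite -/(pairb k) -pk pE pblock_one_block finset.cardsT card_ord neq_lift
    sz.
  by case: size w2 => [|[|]].
set e := nth e0 w k.
have eok : entry_ok e by apply/wok/mem_nth.
have wE : vals w = vals (take k w) ++ entry_val e :: vals (drop k.+1 w).
  by rewrite -[in LHS](cat_take_drop k w) (drop_nth e0 kw) map_cat.
have s1 : size (vals (take k w)) = k by rewrite size_map size_takel // ltnW.
rewrite (@sum_pair_block _ E _ (vals (take k w)) (vals (drop k.+1 w))
  (entry_val e)); first last.
- by rewrite s1.
- by move=> j; rewrite -wE.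
- by have := congr1 size wE; rewrite size_cat /= addnS.
(* The contribution of a pair is additive in the value of each gap, so both sums over partitions can
   be taken inside, where they become values of [E]. *)
pose c a b := iota ((delta e.1.2 * tau (d * a * e.1.1)) *: (e.2 * b)).
have cDl a a' b : c (a + a') b = c a b + c a' b.
  by rewrite /c -iotaD mulrDr mulrDl tauD mulrDr scalerDl.
have c0l b : c 0 b = 0 by rewrite /c mulr0 mul0r tau0 mulr0 scale0r.
have cDr a b b' : c a (b + b') = c a b + c a b'.
  by rewrite /c -iotaD mulrDr scalerDr.
have c0r a : c a 0 = 0 by rewrite /c mulr0 scaler0.
(* In the scalar factor, the [E] around the left gap disappears: it extends over the coefficients in
   D by the bimodule property, and tau is invariant under [E]. *)
transitivity (c (E (prod (take k w))) (E (prod (drop k.+1 w)))); last first.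
  rewrite /c /F; congr (iota (_ * _ *: _)).
  by case: eok => De _ _; rewrite -EM // tauE.
rewrite -!sum_gap_value // (big_morph (c^~ _) (fun a a' => cDl a a' _) (c0l _)).
apply: eq_bigr => u _; rewrite (big_morph (c _) (cDr _) (c0r _)).
apply: eq_bigr => v _.
have Du := gap_value_closed D1 DB DE u; have Dv := gap_value_closed D1 DB DE v.
set e' : entry := (e.1, e.2 * gap_value E v).
have -> : entry_val e * gap_value E v = entry_val e'
  by rewrite /entry_val /= mulrA.
rewrite /G actM; apply: (IH _ [:: e']) => //; first exact: DM.
by move=> x; rewrite inE => /eqP ->; case: eok => *; split => //; apply: DM.
Qed.

(** * Equivalence of the D-valued moment and cumulant equations *)

Variable xi : K.

Let cumulant_spec d w := kappa (act xi d) (vals w) = expected_cumulant d w.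
Let moment_spec d w := EL (act xi (d * prod w)) = iota (expected_moment d w).

Definition valued (P : M -> seq entry -> Prop) : Prop :=
  forall d w, D d -> (forall e, e \in w -> entry_ok e) -> P d w.

(** Strong induction on the length: the moment defect in [kappa_moment] is 0, hence so is the
    cumulant defect. *)
Lemma moment_spec_cumulant : valued moment_spec -> valued cumulant_spec.
Proof.
move=> Q d w; move: {2}(size w).+1 (ltnSn (size w)) => k.
elim: k d w => // k IH d w wk Dd wok.
have := kappa_moment Dd wok (fun d w' Dd wok' ww' =>
  IH d w' (leq_trans ww' wk) Dd wok').
by rewrite Q // subrr => /esym/eqP; rewrite subr_eq0 => /eqP.
Qed.

Definition kappa_equations : Prop :=
  [/\ kappa xi [::] = 0,
      forall d a, D d -> symbol_ok B a ->
        kappa xi [:: d * symbol_val X a] = iota ((delta a * tau d) *: 1)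
    & forall w : seq (M * symbol M n), (2 <= size w)%N ->
        (forall da, da \in w -> D da.1 /\ symbol_ok B da.2) ->
        kappa xi [seq da.1 * symbol_val X da.2 | da <- w] = 0].

Lemma cumulant_spec_kappa : valued cumulant_spec -> kappa_equations.
Proof.
move=> P; split=> [|d a Dd aok|w w2 wok].
- by have := P 1 [::] D1; rewrite /cumulant_spec act1 /=; apply.
- have := P 1 [:: (d, a, 1)] D1;
  rewrite /cumulant_spec act1 /= /entry_val /= mulr1 mul1r.
  by apply=> e; rewrite inE => /eqP ->; split.
- have := P 1 [seq (da, 1) | da <- w] D1; rewrite /cumulant_spec act1 -map_comp.
  have -> : expected_cumulant 1 [seq (da, 1) | da <- w] = 0
    by case: (w) w2 => [|? []].
  rewrite (eq_map (g := fun da => da.1 * symbol_val X da.2)) => [|da];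
    last by rewrite /entry_val /= mulr1.
  by apply=> e /mapP[da /wok[? ?] ->]; split.
Qed.

(* Moves the coefficients of a word d x_1 ... x_m to the left of the symbols:
   the last one is left over. *)
Fixpoint absorb (d : M) (w : seq entry) : seq entry * M :=
  if w is e :: w' then
    let r := absorb e.2 w' in ((d * e.1.1, e.1.2, 1) :: r.1, r.2)
  else ([::], d).

Lemma prod_absorb d w : prod (absorb d w).1 * (absorb d w).2 = d * prod w.
Proof.
elim: w d => [|e w IH] d /=; first by rewrite !big_nil mulr1 mul1r.
by rewrite !big_cons -mulrA IH /entry_val /= mulr1 !mulrA.
Qed.

Lemma absorb_ok d w : D d -> (forall e, e \in w -> entry_ok e) ->
  D (absorb d w).2 /\ forall e, e \in (absorb d w).1 -> entry_ok e.
Proof.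
elim: w d => [|e w IH] d Dd wok //=.
have [e1 e2 e3] := wok _ (mem_head _ _).
have [f fw|r2 r1] := IH e.2 e3; first by apply: wok; rewrite inE fw orbT.
split=> // f; rewrite inE => /orP[/eqP->|/r1//]; split=> //; exact: DM.
Qed.

Lemma absorb_right1 d w e : e \in (absorb d w).1 -> e.2 = 1.
Proof.
by elim: w d => //= f w IH d; rewrite inE => /orP[/eqP->//|/IH].
Qed.

Lemma size_absorb d w : size (absorb d w).1 = size w.
Proof. by elim: w d => //= e w IH d; rewrite IH. Qed.

(** A coefficient shifted across the paired letter enters [E] from the left, and the leftover one
    from the right; the bimodule property of [E] balances both. *)
Lemma expected_moment_absorb y d w :
  D d -> (forall e, e \in w -> entry_ok e) ->
  expected_moment y (absorb d w).1 * (absorb d w).2 = expected_moment (y * d) w.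
Proof.
elim: w y d => [|e w IH] y d Dd wok /=; first by rewrite mul0r.
have [e1 e2 e3] := wok _ (mem_head _ _).
have wok' f : f \in w -> entry_ok f by move=> fw; apply: wok;
  rewrite inE fw orbT.
have [Dr _] := absorb_ok e3 wok'.
rewrite mulrDl IH // mul1r -scalerAl; congr (_ *: _ + _);
  first by rewrite !mulrA.
  have := EM (prod (absorb e.2 w).1) D1 Dr; rewrite !mul1r => <-.
  by have := EM (prod w) e3 D1; rewrite !mulr1 prod_absorb.
by rewrite /entry_val /= mulr1 !mulrA.
Qed.

(** [kappa_equations] only covers words with coefficient 1 next to [xi] and to the right of every
    symbol. The word is brought to this shape by [absorb], and the leftover coefficient is pulled
    out of [EL] at the end. *)
Lemma kappa_moment_spec : kappa_equations -> valued moment_spec.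
Proof.
move=> [C0 C1 C2] d w; move: {2}(size w).+1 (ltnSn (size w)) => k.
elim: k d w => // k IHk d w wk Dd wok.
(* Moments of shorter words are known from the outer induction; an inner induction on the length
   turns them into cumulants. *)
have {IHk} IH d' w' : D d' -> (forall e, e \in w' -> entry_ok e) ->
    (size w' < size w)%N -> cumulant_spec d' w'.
  move=> Dd' wok' ww'; move: {2}(size w').+1 (ltnSn (size w')) => l.
  elim: l d' w' ww' Dd' wok' => // l IHl d' w' ww' Dd' wok' wl.
  have := kappa_moment Dd' wok' (fun d w2 Dd wok2 w2w' =>
    IHl d w2 (ltn_trans w2w' ww') Dd wok2 (leq_trans w2w' wl)).
  by rewrite IHk ?(leq_trans ww') // subrr => /esym/eqP;
    rewrite subr_eq0 => /eqP.
have [Dr rok] := absorb_ok Dd wok; have szr := size_absorb d w.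
set r := absorb d w in Dr rok szr.
have rE : vals r.1 = [seq da.1 * symbol_val X da.2 | da <-
  [seq e.1 | e <- r.1]].
  rewrite -map_comp; apply/eq_in_map => e /(absorb_right1 (d := d)) e1.
  by rewrite /entry_val e1 mulr1.
have cr : cumulant_spec 1 r.1.
  rewrite /cumulant_spec act1 rE;
    case: (r.1) rok (@absorb_right1 d w) => [|e [|e' r']] rok' r1 //=.
    have [e1 e2 _] := rok' e (mem_head _ _).
    by rewrite C1 // mul1r r1 // mem_head.
  by apply: (C2 [seq f.1 | f <- [:: e, e' & r']]) =>
    // da /mapP[f /rok'[? ? _] ->].
have := @kappa_moment xi _ _ D1 rok; rewrite szr => /(_ IH).
rewrite cr subrr mul1r => /eqP; rewrite subr_eq0 => /eqP Er.
rewrite /moment_spec -prod_absorb -/r -actM EL_act // Er act_iota.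
by rewrite expected_moment_absorb // mul1r.
Qed.

(** * Scalar trace equations and D-valued moments *)

Section Words.
Hypothesis BM : forall a b, B a -> B b -> B (a * b).
Hypothesis DsubB : D `<=` B.
Hypothesis DZ : forall c a, D a -> D (c *: a).
Variable tauL : K -> R[i].
Hypothesis tauL_iota : forall m, tauL (iota m) = tau m.
Hypothesis tauL_EL : forall eta, tauL (EL eta) = tauL eta.
Hypothesis EL_eq : forall eta m, D m ->
  (forall d, D d -> tauL (act eta d) = tau (m * d)) -> EL eta = iota m.

Notation sprod l := (\prod_(a <- l) symbol_val X a).
Notation letters_ok l := (forall a, a \in l -> symbol_ok B a).

(** The right side of the conjugate equations for an arbitrary word of symbols, in which variables
    and elements of B need not alternate; y is the product of the letters already read. *)
Fixpoint symbol_moment (y : M) (l : seq (symbol M n)) : R[i] :=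
  if l is a :: l' then
    delta a * (tau y * tau (sprod l')) + symbol_moment (y * symbol_val X a) l'
  else 0.

Definition symbol_equations : Prop :=
  forall l : seq (symbol M n), letters_ok l ->
    tauL (act xi (sprod l)) = symbol_moment 1 l.

Definition conjugate_equation : Prop :=
  forall (m : nat) (b : nat -> M) (ix : nat -> 'I_n),
    (forall j, (j <= m)%N -> B (b j)) ->
    tauL (act xi (word X b ix 0 m)) =
    \sum_(0 <= r < m) (i == ix r)%:R *
       (tau (word X b ix 0 r) * tau (word X b ix r.+1 m)).

Lemma tauZ c a : tau (c *: a) = c * tau a.
Proof. by have := tau_lin c a 0; rewrite addr0 tau0 addr0. Qed.

Lemma tau_expected_moment y l :
  tau (expected_moment y [seq (1, a, 1) | a <- l]) = symbol_moment y l.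
Proof.
elim: l y => [|a l IH] y //=.
rewrite tauD tauZ IH mul1r mulr1 tauE mulrA /entry_val /= mulr1 mul1r.
rewrite -map_comp big_map (eq_bigr (symbol_val X)) // => b _ /=.
by rewrite /entry_val /= mulr1 mul1r.
Qed.

Lemma moment_spec_symbol : valued moment_spec -> symbol_equations.
Proof.
move=> Q l lok; rewrite -tau_expected_moment -tauL_iota -Q //; last first.
  by move=> e /mapP[a /lok aok ->]; split.
rewrite tauL_EL mul1r big_map big_map; congr (tauL (act xi _)).
by apply: eq_bigr => a _; rewrite /entry_val /= mulr1 mul1r.
Qed.

(** Coefficients in D are elements of B and can be read as symbols; having delta 0, they add no
    terms to [symbol_moment]. *)
Definition letters (w : seq entry) : seq (symbol M n) :=
  flatten [seq [:: inr e.1.1; e.1.2; inr e.2] | e <- w].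

Lemma prod_letters w : sprod (letters w) = prod w.
Proof.
elim: w => [|e w IH]; rewrite ?big_nil //=.
by rewrite !big_cons IH /entry_val /= !mulrA.
Qed.

Lemma letters_letters_ok w :
  (forall e, e \in w -> entry_ok e) -> letters_ok (letters w).
Proof.
move=> wok a /flattenP[t /mapP[e /wok[? ? ?] ->]].
by rewrite !inE => /or3P[]/eqP-> //; apply: DsubB.
Qed.

(** The appended d is the element of D tested against: it passes under [E] by the bimodule property,
    and tau then removes [E]. *)
Lemma symbol_moment_letters y w d : D d -> (forall e, e \in w -> entry_ok e) ->
  symbol_moment y (rcons (letters w) (inr d)) = tau (expected_moment y w * d).
Proof.
move=> Dd; elim: w y => [|e w IH] y wok /=.
  by rewrite big_nil !mul0r add0r tau0.
have [e1 e2 e3] := wok _ (mem_head _ _).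
have wok' f : f \in w -> entry_ok f by move=> fw; apply: wok;
  rewrite inE fw orbT.
rewrite !mul0r !add0r IH // mulrDl tauD -scalerAl tauZ -mulrA /entry_val /=
  !mulrA.
congr (_ * _ + _).
by rewrite big_cons big_rcons /= prod_letters -(EM _ e3 Dd) tauE mulrA.
Qed.

Lemma expected_moment_closed y w : (forall e, e \in w -> entry_ok e) ->
  D (expected_moment y w).
Proof.
elim: w y => [|e w IH] y wok /=; first by rewrite -(subrr 1); apply: DB.
have [_ _ e3] := wok _ (mem_head _ _).
have DD a b : D a -> D b -> D (a + b).
  move=> Da Db; rewrite -(opprK b) -[- b]sub0r; apply/DB/DB => //.
  by rewrite -(subrr 1); apply: DB.
apply: DD; first exact/DZ/DM.
by apply: IH => f fw; apply: wok; rewrite inE fw orbT.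
Qed.

(** By [EL_eq], a value of [EL] in D is determined by its traces against D, and each such trace is
    that of [xi] times a word of symbols. *)
Lemma symbol_moment_spec : symbol_equations -> valued moment_spec.
Proof.
move=> S d w Dd wok; apply: EL_eq => [|d' Dd'].
  exact: expected_moment_closed.
have := S (inr d :: rcons (letters w) (inr d')) _.
rewrite actM big_cons big_rcons /= prod_letters mulrA => ->.
  by rewrite mul0r add0r mul1r symbol_moment_letters.
move=> a; rewrite inE mem_rcons inE => /or3P[/eqP->|/eqP->|]; try exact: DsubB.
exact: letters_letters_ok.
Qed.

(** The symbols following [b k] in the word from k to k + m. The coefficient [b k] is left out so
    that it can be merged with what precedes it. *)
Definition word_tail (b : nat -> M) (ix : nat -> 'I_n) :=
  fix tail m k : seq (symbol M n) :=
    if m is m'.+1 then inl (ix k) :: inr (b k.+1) :: tail m' k.+1 else [::].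

Lemma eq_word_tail b b' ix ix' m k k' :
  (forall j, b (k + j).+1 = b' (k' + j).+1) ->
  (forall j, ix (k + j)%N = ix' (k' + j)%N) ->
  word_tail b ix m k = word_tail b' ix' m k'.
Proof.
elim: m k k' => //= m IH k k' bE ixE.
have := (bE 0%N, ixE 0%N); rewrite !addn0 => -[-> ->].
by rewrite (IH _ k'.+1) // => j; rewrite !addSnnS.
Qed.

Definition word_letters b ix m := inr (b 0%N) :: word_tail b ix m 0%N.

Lemma prod_word_tail b ix m k :
  b k * sprod (word_tail b ix m k) = word X b ix k (k + m).
Proof.
rewrite /word; congr (_ * _).
elim: m k => [|m IH] k /=; first by rewrite big_nil addn0 big_geq.
by rewrite !big_cons mulrA IH [RHS]big_ltn ?addSnnS // -addSnnS leq_addr.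
Qed.

Lemma symbol_moment_tail b ix y m k :
  symbol_moment (y * b k) (word_tail b ix m k) =
  \sum_(k <= r < k + m) (i == ix r)%:R *
     (tau (y * word X b ix k r) * tau (word X b ix r.+1 (k + m))).
Proof.
elim: m k y => [|m IH] k y /=; first by rewrite addn0 big_geq.
rewrite big_ltn; last by rewrite addnS ltnS leq_addr.
rewrite mul0r add0r big_cons /= prod_word_tail eq_sym addSnnS.
rewrite {2}/word big_geq // mulr1; congr (_ + _).
rewrite IH addSnnS; apply: eq_big_nat => r /andP[kr _].
congr (_ * (tau _ * _)); rewrite /word (big_ltn kr) !mulrA.
by [].
Qed.

Lemma symbol_conjugate : symbol_equations -> conjugate_equation.
Proof.
move=> S m b ix bB.
have := S (word_letters b ix m) _.
rewrite big_cons /= prod_word_tail mul0r add0r symbol_moment_tail add0n => ->.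
  by apply: eq_bigr => r _; rewrite mul1r.
have tailB k l : (k + l <= m)%N -> letters_ok (word_tail b ix l k).
  elim: l k => //= l IH k klm a; rewrite !inE => /or3P[/eqP->//|/eqP->|].
    by apply: bB; rewrite (leq_trans _ klm) // addnS ltnS leq_addr.
  by apply: IH; rewrite addSnnS.
move=> a; rewrite inE => /orP[/eqP->|]; first exact: bB.
exact: tailB.
Qed.

(** Any word of symbols can be made alternating without changing its product or its symbol moment: a
    1 is put before each variable and adjacent elements of B are multiplied. *)
Lemma conjugate_symbol : conjugate_equation -> symbol_equations.
Proof.
move=> C l lok.
suff [m [b [ix [bB lE symE]]]] : exists m b ix, [/\ forall j, B (b j),
    sprod l = word X b ix 0 m
  & forall y, symbol_moment y l = symbol_moment y (word_letters b ix m)].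
  rewrite lE C // symE /= mul0r add0r symbol_moment_tail add0n.
  by apply: eq_bigr => r _; rewrite mul1r.
elim: l lok => [|a l IH] lok.
  exists 0%N, (fun=> 1), (fun=> i); split=> [j||y]; first exact: DsubB.
    by rewrite big_nil /word big_geq // mulr1.
  by rewrite /= mul0r addr0.
case: IH => [b bl|m [b [ix [bB lE symE]]]]; first by apply: lok;
  rewrite inE bl orbT.
have := lok _ (mem_head _ _); case: a {lok} => [k _|c Bc].
  (* A leading variable shifts all indices by one and is preceded by the new coefficient 1. *)
  exists m.+1, (fun j => if j is j'.+1 then b j' else 1), (fun j =>
    if j is j'.+1 then ix j' else k).
  have tE := @eq_word_tail (fun j => if j is j'.+1 then b j' else 1) b
    (fun j => if j is j'.+1 then ix j' else k) ix m 1 0 (fun=> erefl) (fun=>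
      erefl).
  split=> [[|j]||y] //; first exact: DsubB.
    rewrite -prod_word_tail /= !big_cons tE /= mul1r; congr (_ * _).
    by rewrite prod_word_tail.
  by rewrite /= tE !mul0r !add0r mulr1 big_cons prod_word_tail symE lE /= mul0r
    add0r.
(* A leading element c of B is merged into the first coefficient. *)
exists m, (fun j => if j is j'.+1 then b j else c * b j), ix.
have tE := @eq_word_tail (fun j =>
  if j is j'.+1 then b j else c * b j) b ix ix m 0 0
  (fun=> erefl) (fun=> erefl).
split=> [[|j]||y] //; first exact: BM.
  rewrite -prod_word_tail tE /= big_cons -mulrA prod_word_tail lE.
  by [].
by rewrite /= tE !mul0r !add0r symE /= mul0r add0r mulrA.
Qed.

Lemma conjugate_kappa : conjugate_equation <-> kappa_equations.
Proof.
split=> [C|K0].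
  apply/cumulant_spec_kappa/moment_spec_cumulant/symbol_moment_spec.
  exact: conjugate_symbol.
exact/symbol_conjugate/moment_spec_symbol/kappa_moment_spec.
Qed.
End Words.
End Equivalence.

(** * The Hilbert space L^2(M, tau) *)

Section Hilbert.
Variables (R : realType) (H : normedModType R[i]) (dot : {dot H for Num.conj}).
Hypothesis hH : hilbert dot.

Lemma dotC u v : dot u v = Num.conj (dot v u).
Proof. by rewrite (hermC dot u v) expr0 mul1r. Qed.

Lemma dot_CauchySchwarz u v : `|dot u v| <= `|u| * `|v|.
Proof.
have [->|v0] := eqVneq v 0; first by rewrite linear0r !normr0 mulr0.
have v_gt0 : 0 < `|v| ^+ 2 by rewrite exprn_gt0 // normr_gt0.
rewrite -ler_sqr ?nnegrE ?mulr_ge0 // exprMn.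
set s := `|v| ^+ 2; set c := dot u v.
have s_real : Num.conj s = s by rewrite conj_Creal // realX // realE normr_ge0.
(* The vector [s *: u - c *: v] is s times the component of u orthogonal to v; expanding its squared
   norm gives the inequality multiplied by s. *)
have := dnorm_ge0 dot (s *: u - c *: v).
rewrite dnormB !dnormZ -!hH linearZl_LR /= linearZr_LR /= -/c.
have cross (t z : R[i]) : Num.conj t = t ->
    t * (Num.conj z * z) + Num.conj (t * (Num.conj z * z)) = t * `|z| ^+ 2 *+ 2.
  by move=> tE; rewrite !rmorphM /= conjCK tE [z * _]mulrC -normCKC mulr2n.
rewrite cross //.
rewrite -/s normrX normr_id -/s.
have -> : s ^+ 2 * `|u| ^+ 2 + `|c| ^+ 2 * s - s * `|c| ^+ 2 *+ 2 =
    s * (`|u| ^+ 2 * s - `|c| ^+ 2) by ring.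
by rewrite pmulr_rge0 // subr_ge0.
Qed.

Lemma dot_inj u v : (forall w, dot w u = dot w v) -> u = v.
Proof.
move=> uv; apply/eqP; rewrite -subr_eq0 -(dnorm_eq0 dot).
by rewrite linearBr /= uv subrr.
Qed.
End Hilbert.

(** * Sequences in normed spaces over the complex numbers *)

Section Convergence.
Variables (R : realType).

(** A positive complex number is real, so the archimedean property of R applies to it. *)
Lemma complex_archi (e : R[i]) : 0 < e ->
  exists N, forall k, (N <= k)%N -> k.+1%:R^-1 < e.
Proof.
move=> e0; have [x xE] : exists x : R, e = x%:C.
  by exists (complex.Re e); move: e0; case: e => a b;
    rewrite ltcE /= => /andP[/eqP -> _].
move: e0; rewrite xE ltcR => x0; exists (Num.bound x^-1) => k Nk.
rewrite -(rmorph_nat (real_complex R)) -fmorphV ltcR.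
rewrite invf_plt ?posrE ?ltr0n //.
have xV0 : 0 <= x^-1 by rewrite invr_ge0 ltW.
by apply: lt_le_trans (archi_boundP xV0) _; rewrite ler_nat leqW.
Qed.

Lemma dense_sequence (K : normedModType R[i]) (T : Type) (f : T -> K) (xi : K) :
  closure (range f) xi -> exists u : nat -> T, f (u k) @[k --> \oo] --> xi.
Proof.
move=> cl; have /choice[u uP] k : exists x, `|xi - f x| < k.+1%:R^-1.
  have k0 : 0 < k.+1%:R^-1 :> R[i] by rewrite invr_gt0 ltr0n.
  have [_ [[x _ <-] /= B]] := cl _ (nbhsx_ballx xi _ k0).
  by exists x; rewrite -ball_normE in B.
exists u; apply/cvgrPdist_lt => e e0; have [N NP] := complex_archi e0.
by exists N => // k /= Nk; apply: lt_trans (uP k) (NP k Nk).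
Qed.

Lemma cvg_bounded (K L : normedModType R[i]) (f : nat -> K) (g : nat -> L)
    x y C :
  0 < C -> (forall k, `|y - g k| <= C * `|x - f k|) ->
  f k @[k --> \oo] --> x -> g k @[k --> \oo] --> y.
Proof.
move=> C0 fg /cvgrPdist_lt fx; apply/cvgrPdist_lt => e e0.
have := fx (e / C) (divr_gt0 e0 C0); apply: filterS => k fk.
by apply: le_lt_trans (fg k) _; rewrite mulrC -ltr_pdivlMr.
Qed.
End Convergence.

(** * The involution and the boundedness of right multiplication *)

Section VonNeumann.
Variables (R : realType) (H : normedModType R[i]) (dot : {dot H for Num.conj}).
Variables (M : algType R[i]) (star : M -> M) (rep : M -> H -> H)
  (tau : M -> R[i]).
Hypothesis hH : hilbert dot.
Hypothesis vN : is_von_neumann dot star rep.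
Hypothesis tauP : faithful_normal_tracial_state dot star rep tau.

Let rep_inj : injective rep. Proof. by case: vN. Qed.
Let rep1 u : rep 1 u = u. Proof. by case: vN => _ [-> _]. Qed.
Let repM a b u : rep (a * b) u = rep a (rep b u).
Proof. by case: vN => _ [_ ->]. Qed.
Let adj a u v : dot (rep a u) v = dot u (rep (star a) v).
Proof. by case: vN => _ _ _ + _; apply. Qed.

Let rep_eq a b : (forall u v, dot (rep a u) v = dot (rep b u) v) -> a = b.
Proof.
move=> ab; apply: rep_inj; apply/funext => u;
  apply: (dot_inj (dot := dot)) => w.
by rewrite dotC ab -dotC.
Qed.

Lemma starK a : star (star a) = a.
Proof.
apply: rep_eq => u v.
by rewrite [RHS]adj [RHS]dotC [in RHS]adj -dotC.
Qed.

Lemma starM a b : star (a * b) = star b * star a.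
Proof.
apply: rep_eq => u v.
by rewrite adj starK [in RHS]repM !adj !starK repM.
Qed.

Lemma star1 : star 1 = 1.
Proof.
apply: rep_eq => u v; rewrite rep1.
by rewrite adj starK rep1.
Qed.

Lemma rep_bounded a :
  exists2 C : R[i], 0 < C & forall u, `|rep a u| <= C * `|u|.
Proof.
have [linT contT] : bounded_operator (rep a).
  by case: vN => _ _ _ _ [vNr _ _]; apply: vNr; exists a.
pose T : {linear H -> H} := HB.pack (rep a) (GRing.isLinear.Build _ _ _ _ _
  linT).
have /linear_bounded_continuous/linear_boundedP/pinfty_ex_gt0[C C0 CP] :
  continuous T by [].
by exists C.
Qed.

(** With C a bound for the operator of [star a], the element [C ^+ 2 *: (x * star x) - x * a * star
    (x * a)] is a positive operator, and tau is positive. *)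
Lemma tau_mulr_bounded a : exists2 C : R[i], 0 < C &
  forall x, tau (x * a * star (x * a)) <= C ^+ 2 * tau (x * star x).
Proof.
have [C C0 CP] := rep_bounded (star a); exists C => // x.
case: tauP => [[tau_lin _] tau_pos _ _ _].
have rep_lin c y z u : rep (c *: y + z) u = c *: rep y u + rep z u by case: vN.
have repB y z u : rep (y - z) u = rep y u - rep z u.
  by rewrite -scaleN1r addrC rep_lin scaleN1r addrC.
set P := C ^+ 2 *: (x * star x) - x * a * star (x * a).
have : 0 <= tau P.
  apply: tau_pos => u; rewrite subr0 repB.
  have -> : rep (C ^+ 2 *: (x * star x)) u = C ^+ 2 *: rep (x * star x) u.
    have := rep_lin (C ^+ 2) (x * star x) 0 u; rewrite addr0 => ->.
    have := repB 0 0 u; rewrite subrr => ->; by rewrite subrr addr0.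
  have E1 : dot (rep (x * star x) u) u = `|rep (star x) u| ^+ 2
    by rewrite repM adj -hH.
  have E2 : dot (rep (x * a * star (x * a)) u) u = `|rep (star a) (rep (star x)
    u)| ^+ 2.
    by rewrite starM !repM adj adj -hH.
  rewrite linearBl /= linearZl_LR /= E1 E2 subr_ge0 -exprMn ler_sqr ?nnegrE //.
  by rewrite mulr_ge0 // ltW.
have tau0 : tau 0 = 0 by have := tau_lin (-1) 0 0;
  rewrite scaler0 addr0 mulN1r addNr.
have tauZ c y : tau (c *: y) = c * tau y by have := tau_lin c y 0;
  rewrite !addr0 tau0 addr0.
by rewrite /P addrC -scaleN1r tau_lin tauZ mulN1r addrC subr_ge0.
Qed.
End VonNeumann.

(** * Extension by continuity from M to its completion *)

Section L2Extension.
Variables (R : realType) (M : algType R[i]) (K : completeNormedModType R[i]).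
Variable iota : M -> K.
Hypothesis iota_lin : forall c a b, iota (c *: a + b) = c *: iota a + iota b.
Hypothesis iota_dense : closure (range iota) = setT.

Lemma L2_sequence (xi : K) : exists u :
  nat -> M, iota (u k) @[k --> \oo] --> xi.
Proof. by apply: dense_sequence; rewrite iota_dense. Qed.

Lemma limit_eq (T : normedModType R[i]) (u : nat -> T) (x y : T) :
  u k @[k --> \oo] --> x -> u k @[k --> \oo] --> y -> x = y.
Proof. by move=> ux uy; apply: (cvg_unique (@norm_hausdorff _ T)) ux uy. Qed.

(** By density some sequence in M tends to [xi], so at most one value qualifies and the choice made
    by [xget] is forced. *)
Lemma L2_ext_eq (T : normedModType R[i]) (g : M -> T) (xi : K) (y : T) :
  (forall u : nat -> M,
    iota (u k) @[k --> \oo] --> xi -> g (u k) @[k --> \oo] --> y) ->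
  L2_ext iota g xi = y.
Proof.
move=> gy; apply: xget_unique => // z gz.
by have [u uxi] := L2_sequence xi; apply: limit_eq (gz u uxi) (gy u uxi).
Qed.

Section Bounded.
Variables (T : completeNormedModType R[i]) (g : M -> T).
Hypothesis gB : forall a b, g (a - b) = g a - g b.
Hypothesis g_bounded : exists2 C :
  R[i], 0 < C & forall a, `|g a| <= C * `|iota a|.

Let iotaB a b : iota (a - b) = iota a - iota b.
Proof. by rewrite -scaleN1r addrC iota_lin scaleN1r addrC. Qed.

(** A Lipschitz map sends one approximating sequence to a Cauchy sequence. Another sequence with the
    same limit differs from it by a null sequence, whose image is null too. *)
Lemma L2_ext_cvg (xi : K) (u : nat -> M) : iota (u k) @[k --> \oo] --> xi ->
  g (u k) @[k --> \oo] --> L2_ext iota g xi.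
Proof.
have [C C0 gC] := g_bounded.
have gCB a b : `|g a - g b| <= C * `|iota a - iota b| by rewrite -gB -iotaB.
have [v vxi] := L2_sequence xi.
have /cauchy_cvgP/cvg_ex[y gvy] : cauchy (g (v k) @[k --> \oo]).
  apply: cauchy_exP => e e0.
  (* Two terms within e / C / 2 of [xi] are within e / C of each other, hence their images under [g]
     are within e. *)
  have e2 : 0 < e / C / 2 by rewrite !divr_gt0.
  have [N _ vN] : \forall k \near \oo, `|xi - iota (v k)| < e / C / 2.
    by move/cvgrPdist_lt: vxi; apply.
  exists (g (v N)), N => // k /= Nk; rewrite -ball_normE /=.
  apply: le_lt_trans (gCB _ _) _; rewrite mulrC -ltr_pdivlMr //.
  apply: le_lt_trans (ler_distD xi _ _) _; rewrite [ltRHS]splitr ltrD //.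
    by rewrite distrC; apply: vN => /=.
  exact: vN.
suff gy w : iota (w k) @[k --> \oo] --> xi -> g (w k) @[k --> \oo] --> y.
  by rewrite (@L2_ext_eq _ g xi y) //; apply: gy.
move=> wxi.
have wv : (iota (w k) - iota (v k)) @[k --> \oo] --> xi - xi
  by exact: (cvgB wxi vxi).
have gwv : (g (w k) - g (v k)) @[k --> \oo] --> (0 : T).
  apply: (cvg_bounded C0 _ wv) => k; rewrite sub0r normrN subrr sub0r normrN.
  exact: gCB.
have -> : (fun k => g (w k)) = (fun k => (g (w k) - g (v k)) + g (v k)).
  by apply/funext => k; rewrite subrK.
by rewrite -[y]add0r; exact: (cvgD gwv gvy).
Qed.

Lemma L2_ext_iota m : L2_ext iota g (iota m) = g m.
Proof.
have c : iota m @[k --> \oo] --> iota m by apply: cvg_cst.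
by apply: (limit_eq (L2_ext_cvg (u := fun=> m) c)); apply: cvg_cst.
Qed.
End Bounded.
End L2Extension.

(** * Right multiplication, conditional expectation and trace on L^2 *)

Section L2Trace.
Variables (R : realType) (H : completeNormedModType R[i])
  (dotH : {dot H for Num.conj}).
Variables (M : algType R[i]) (star : M -> M) (rep : M -> H -> H)
  (tau : M -> R[i]).
Variables (K : completeNormedModType R[i]) (dotK : {dot K for Num.conj}).
Variables (iota : M -> K) (D : set M) (E : M -> M).
Hypothesis hH : hilbert dotH.
Hypothesis vN : is_von_neumann dotH star rep.
Hypothesis tauP : faithful_normal_tracial_state dotH star rep tau.
Hypothesis L2P : is_L2 star tau dotK iota.
Hypothesis D_star : unital_star_subalgebra star D.
Hypothesis EP : conditional_expectation D E.
Hypothesis tauE : forall m, tau (E m) = tau m.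

Let hK : hilbert dotK. Proof. by case: L2P. Qed.
Let iota_lin c a b : iota (c *: a + b) = c *: iota a + iota b.
Proof. by case: L2P. Qed.
Let dot_iota a b : dotK (iota a) (iota b) = tau (a * star b).
Proof. by case: L2P. Qed.
Let dense : closure (range iota) = setT. Proof. by case: L2P. Qed.
Let iotaB a b : iota (a - b) = iota a - iota b.
Proof. by rewrite -scaleN1r addrC iota_lin scaleN1r addrC. Qed.

Let EB a b : E (a - b) = E a - E b.
Proof. by case: EP => El _ _ _; rewrite -scaleN1r addrC El scaleN1r addrC. Qed.
Let D1 : D 1. Proof. by case: D_star. Qed.
Let Dlin c a b : D a -> D b -> D (c *: a + b).
Proof. by case: D_star => _ + _ _; apply. Qed.
Let DM a b : D a -> D b -> D (a * b).
Proof. by case: D_star => _ _ + _; apply. Qed.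
Let Dstar a : D a -> D (star a). Proof. by case: D_star => _ _ _; apply. Qed.
Let DE a : D (E a). Proof. by case: EP. Qed.
Let DB a b : D a -> D b -> D (a - b).
Proof. by move=> Da Db; rewrite -scaleN1r addrC; apply: Dlin. Qed.
Let EM d m d' : D d -> D d' -> E (d * m * d') = d * E m * d'.
Proof. by case: EP => _ _ _; apply. Qed.
Let EMr m d : D d -> E (m * d) = E m * d.
Proof. by move=> Dd; have := EM m D1 Dd; rewrite !mul1r. Qed.

Lemma mulr_bounded a : exists2 C : R[i], 0 < C &
  forall x, `|iota (x * a)| <= C * `|iota x|.
Proof.
have [C C0 CP] := tau_mulr_bounded hH vN tauP a; exists C => // x.
have Cx : 0 <= C * `|iota x| by rewrite mulr_ge0 // ltW.
rewrite -ler_sqr ?nnegrE // exprMn !hK !dot_iota.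
exact: CP.
Qed.

(** [E] is a contraction: as tau is invariant under [E], the squared norm of [E x] is the inner
    product of x and [E x], and the Cauchy-Schwarz inequality applies. *)
Lemma condexp_bounded : exists2 C : R[i], 0 < C &
  forall x, `|iota (E x)| <= C * `|iota x|.
Proof.
exists 1 => // x; rewrite mul1r.
have [->|Ex0] := eqVneq (iota (E x)) 0; first by rewrite normr0.
have : `|iota (E x)| ^+ 2 <= `|iota x| * `|iota (E x)|.
  have := dot_CauchySchwarz hK (iota x) (iota (E x)).
  rewrite dot_iota -tauE EMr; last exact/Dstar.
  by rewrite -dot_iota -hK normrX normr_id.
by rewrite expr2 ler_pM2r // normr_gt0.
Qed.

Notation act := (L2_mulr iota).
Notation EL := (L2_condexp iota E).
Notation tauL := (L2_tau tau iota).

Lemma mulr_cvg (xi : K) (u : nat -> M) a : iota (u k) @[k --> \oo] --> xi ->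
  iota (u k * a) @[k --> \oo] --> act xi a.
Proof.
apply: (L2_ext_cvg iota_lin dense (g := fun x =>
  iota (x * a))) (mulr_bounded a) _ _.
by move=> x y; rewrite mulrBl iotaB.
Qed.

Arguments mulr_cvg {xi u} a.

Lemma condexp_cvg (xi : K) (u : nat -> M) : iota (u k) @[k --> \oo] --> xi ->
  iota (E (u k)) @[k --> \oo] --> EL xi.
Proof.
apply: (L2_ext_cvg iota_lin dense (g := iota \o E)) condexp_bounded _ _.
by move=> x y; rewrite /= EB iotaB.
Qed.

(** The identity holds on M and passes to the limit along a sequence tending to [xi]; several
    identities below are obtained in the same way. *)
Lemma L2_mulr1 xi : act xi 1 = xi.
Proof.
have [u uxi] := L2_sequence dense xi.
apply: limit_eq (mulr_cvg 1 uxi) _.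
by have -> : (fun k => iota (u k * 1)) = (fun k => iota (u k))
  by apply/funext => k; rewrite mulr1.
Qed.

Lemma L2_mulrA xi a b : act (act xi a) b = act xi (a * b).
Proof.
have [u uxi] := L2_sequence dense xi.
apply: limit_eq (mulr_cvg b (mulr_cvg a uxi)) _.
have -> : (fun k => iota (u k * a * b)) = (fun k => iota (u k * (a * b))).
  by apply/funext => k; rewrite mulrA.
exact: mulr_cvg.
Qed.

Lemma L2_mulr_iota m a : act (iota m) a = iota (m * a).
Proof. apply: (L2_ext_iota iota_lin dense (g := fun x =>
  iota (x * a))) (mulr_bounded a) _.
by move=> x y; rewrite mulrBl iotaB.
Qed.

Lemma L2_condexp_mulr xi d : D d -> EL (act xi d) = act (EL xi) d.
Proof.
move=> Dd; have [u uxi] := L2_sequence dense xi.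
apply: limit_eq (condexp_cvg (mulr_cvg d uxi)) _.
have -> : (fun k => iota (E (u k * d))) = (fun k => iota (E (u k) * d)).
  by apply/funext => k; rewrite EMr.
exact/mulr_cvg/condexp_cvg.
Qed.

Lemma dot_cvg (xi eta : K) (u : nat -> K) : u k @[k --> \oo] --> xi ->
  (dotK (u k) eta : R[i]^o) @[k --> \oo] --> (dotK xi eta : R[i]^o).
Proof.
(* The summand 1 keeps the constant positive when [eta] is 0. *)
apply: (@cvg_bounded _ _ _ _ _ _ _ (`|eta| + 1)); first by rewrite ltr_wpDl.
move=> k; rewrite -linearBl /=.
apply: le_trans (dot_CauchySchwarz hK _ _) _; rewrite mulrC ler_wpM2r //.
by rewrite lerDl.
Qed.

Arguments dot_cvg {xi} eta {u}.

Lemma L2_tauE xi : tauL xi = dotK xi (iota 1).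
Proof.
apply: (L2_ext_eq dense (T := R[i]^o)) => u uxi.
have -> : (fun k => tau (u k)) = (fun k => dotK (iota (u k)) (iota 1)).
  by apply/funext => k; rewrite dot_iota (star1 vN) mulr1.
exact: dot_cvg.
Qed.

Lemma L2_tau_iota m : tauL (iota m) = tau m.
Proof. by rewrite L2_tauE dot_iota (star1 vN) mulr1. Qed.

Lemma L2_tau_condexp xi : tauL (EL xi) = tauL xi.
Proof.
rewrite !L2_tauE; have [u uxi] := L2_sequence dense xi.
apply: (@limit_eq _ R[i]^o) (dot_cvg _ (condexp_cvg uxi)) _.
have -> : (fun k => dotK (iota (E (u k))) (iota 1)) = (fun k =>
  dotK (iota (u k)) (iota 1)).
  by apply/funext => k; rewrite !dot_iota (star1 vN) !mulr1 tauE.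
exact: dot_cvg.
Qed.

Lemma dot_iota_tau xi a : dotK xi (iota a) = tauL (act xi (star a)).
Proof.
rewrite L2_tauE; have [u uxi] := L2_sequence dense xi.
apply: (@limit_eq _ R[i]^o) (dot_cvg _ uxi) _.
have -> : (fun k => dotK (iota (u k)) (iota a)) =
    (fun k => dotK (iota (u k * star a)) (iota 1)).
  by apply/funext => k; rewrite !dot_iota (star1 vN) mulr1.
exact/dot_cvg/mulr_cvg.
Qed.

(** The difference z of the two sides is orthogonal to D, yet it is a limit of the elements
    [E (u k) - m] of D; so z is orthogonal to itself. *)
Lemma L2_condexp_eq xi m : D m ->
  (forall d, D d -> tauL (act xi d) = tau (m * d)) -> EL xi = iota m.
Proof.
move=> Dm xim; apply/eqP; rewrite -subr_eq0; set z := EL xi - iota m.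
have zD d : D d -> dotK z (iota d) = 0.
  move=> Dd; rewrite linearBl /= dot_iota_tau dot_iota -L2_condexp_mulr
    ?L2_tau_condexp; last exact: Dstar.
  by rewrite xim ?subrr //; apply: Dstar.
have [u uxi] := L2_sequence dense xi.
have vz : iota (E (u k) - m) @[k --> \oo] --> z.
  have -> : (fun k => iota (E (u k) - m)) = (fun k => iota (E (u k)) - iota m).
    by apply/funext => k; rewrite iotaB.
  exact: (cvgB (condexp_cvg uxi) (cvg_cst (iota m))).
rewrite -(dnorm_eq0 dotK).
have := dot_cvg z vz.
have -> : (fun k => dotK (iota (E (u k) - m)) z) = (fun=> 0).
  by apply/funext => k; rewrite dotC zD ?rmorph0 //; apply: DB.
move=> c0; apply/eqP; apply: (@limit_eq _ R[i]^o) c0 _; exact: cvg_cst.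
Qed.
End L2Trace.

Theorem theorem4p1 (R : realType)
  (H : completeNormedModType R[i]) (dotH : {dot H for Num.conj})
  (M : algType R[i]) (star : M -> M) (rep : M -> H -> H) (tau : M -> R[i])
  (K : completeNormedModType R[i]) (dotK : {dot K for Num.conj})
  (iota : M -> K)
  (B D : set M) (E : M -> M) (n : nat) (X : 'I_n -> M) (J : 'I_n -> K) :
  hilbert dotH ->
  is_von_neumann dotH star rep ->
  faithful_normal_tracial_state dotH star rep tau ->
  is_L2 star tau dotK iota ->
  unital_star_subalgebra star B ->
  (forall i, star (X i) = X i) ->
  (forall i, L2_generated iota dotH rep (range X `|` B) (J i)) ->
  unital_star_subalgebra star D ->
  D `<=` B ->
  conditional_expectation D E ->
  (forall m, tau (E m) = tau m) ->
  (conjugate_equations tau iota X B J <->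
   cumulant_equations tau iota X B D E J).
Proof.
move=> hH vN tauP L2P [B1 Blin BM Bstar] _ _ DP DsubB EP tauE.
have [D1 Dlin DM Dstar] := DP.
have [[tau_lin _] _ _ _ _] := tauP.
have [_ iota_lin _ _] := L2P.
have [_ E1 DE EM] := EP.
have DB a b : D a -> D b -> D (a - b).
  by move=> Da Db; rewrite -scaleN1r addrC; apply: Dlin.
have DZ c a : D a -> D (c *: a).
  by move=> Da; rewrite -[c *: a]addr0 -(subrr 1); apply: Dlin => //; apply: DB.
(* Both systems split over i, so the equivalence for a single vector is applied to each [J i]. *)
have eqv i := @conjugate_kappa R M K tau iota (L2_mulr iota) (L2_condexp iota E)
  E B D n X D1 DB DM DE E1 (fun a m b Da Db =>
    EM a m b Da Db) tau_lin tauE iota_lin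
  (L2_mulr1 hH vN tauP L2P) (L2_mulrA hH vN tauP L2P)
  (L2_mulr_iota hH vN tauP L2P)
  (fun xi d => L2_condexp_mulr hH vN tauP L2P DP EP tauE xi (d := d)) i (J i)
  BM DsubB DZ (L2_tau tau iota) (L2_tau_iota vN L2P)
  (L2_tau_condexp vN L2P DP EP tauE)
  (fun xi m => L2_condexp_eq hH vN tauP L2P DP EP tauE (xi := xi) (m := m)).
split=> [C|[C0 C1 C2]].
  have K0 i : kappa_equations tau iota (L2_mulr iota) (L2_condexp iota E) E B D
    X i (J i).
    by apply/eqv => m b ix; apply: C.
  by split=> i; case: (K0 i).
move=> m b i ix; move: m b ix; apply/eqv.
by split; [exact: C0 | exact: C1 | exact: C2].
Qed.
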